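(* Let $$C_{4}(\alpha) := \frac{(1- \alpha^2)^3}{1 + \alpha^2} \, \sqrt{C_{2}(\alpha)^2 + C_{3}(\alpha)}.$$ Then for every positive integer $n$, $$d_{Kol}\left( \sqrt{\frac{(1- \alpha^2)^3}{1+\alpha^2}}\, \sqrt{n} \, Z_{12}^{n}, \, \mathcal{N}(0,1) \right) \leq \frac{C_{4}(\alpha)}{\sqrt{n}},\qquad d_{W}\left( \sqrt{\frac{(1- \alpha^2)^3}{1+\alpha^2}}\, \sqrt{n} \, Z_{12}^{n}, \, \mathcal{N}(0,1) \right) \leq \frac{ \sqrt{2/\pi} \,C_{4}(\alpha)}{\sqrt{n}}.$$ In particular, $\sqrt{n}\, Z_{12}^{n}$ converges in distribution to $\mathcal{N}\left( 0, \frac{1+\alpha^2}{(1- \alpha^2)^3}\right)$ as $n$ tends to $\infty$.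
   Context: Let $\alpha\in\mathbb{R}$ with $|\alpha|<1$, and let $\xi_1,\xi_2,\dots,\eta_1,\eta_2,\dots$ be independent standard normal random variables. Define $X_0=Y_0=0$ and $X_n=\alpha X_{n-1}+\xi_n$, $Y_n=\alpha Y_{n-1}+\eta_n$ for $n\ge 1$, and $Z_{12}^n=\frac1n\sum_{i=1}^n X_iY_i-\frac1{n^2}\left(\sum_{i=1}^n X_i\right)\left(\sum_{i=1}^n Y_i\right)$. $d_{Kol}(X,Y)=\sup_{z\in\mathbb{R}}|P(X\le z)-P(Y\le z)|$ (Kolmogorov distance between laws); $d_W(X,Y)=\sup_{f}|Ef(X)-Ef(Y)|$, supremum over all $f:\mathbb{R}\to\mathbb{R}$ Lipschitz with constant $\le 1$ (Wasserstein distance); $\mathcal N(0,1)$ stands for a standard normal random variable. Constants: $C_2(\alpha)=\frac{4}{(1-\alpha^2)^3}\sup_{m\ge1}m\alpha^{2m+2}+\frac{4\alpha^2+\alpha^4}{(1-\alpha^2)^4}+\frac{8}{(1-\alpha)^2(1-\alpha^2)}+\frac{16|\alpha|}{(1-|\alpha|)(1-\alpha)^2(1-\alpha^2)}+\frac{16}{(1-\alpha)^4}$ (sup over positive integers $m$); $C_3(\alpha)=\left(\frac{2^{4/3}}{(1-\alpha^2)^{4/3}(1-|\alpha|^{4/3})}+\frac{16}{(1-\alpha)^{8/3}}\right)^3$. *)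

(* Defs.v *)
From HB Require Import structures.
From mathcomp Require Import all_boot all_order all_algebra.
From mathcomp Require Import finmap.
From mathcomp Require Import all_classical all_reals all_analysis measurable_realfun.

Set Implicit Arguments.
Unset Strict Implicit.
Unset Printing Implicit Defensive.

Import Order.TTheory GRing.Theory Num.Theory.
Import numFieldNormedType.Exports.

Local Open Scope classical_set_scope.
Local Open Scope ring_scope.

(* Product rule over every finite subfamily, hence mutual (not merely
   pairwise) independence. *)
Definition mutually_independent (d : measure_display) (T : measurableType d)
    (R : realType) (P : probability T R) (I : choiceType)
    (V : I -> {RV P >-> R}) : Prop :=
  forall (J : {fset I}) (A : I -> set R), (forall i, measurable (A i)) ->
    P (\bigcap_(i in [set` J]) (V i @^-1` A i)) =
    (\prod_(i <- J) P (V i @^-1` A i))%E.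

Definition sum_family (T : Type) (u v : nat -> T) (i : nat + nat) : T :=
  match i with inl n => u n | inr n => v n end.

(* [xi n] and [eta n] stand for the mathematical xi_(n+1) and eta_(n+1), so
   that X_(n+1) = alpha X_n + xi_(n+1) reads [alpha * X n + xi n] in [ar1]. *)
Definition iid_standard_normal_noises (d : measure_display)
    (T : measurableType d) (R : realType) (P : probability T R)
    (xi eta : nat -> {RV P >-> R}) : Prop :=
  [/\ forall n (A : set R), measurable A ->
        distribution P (xi n) A = normal_prob 0 1 A,
      forall n (A : set R), measurable A ->
        distribution P (eta n) A = normal_prob 0 1 A
    & mutually_independent (sum_family xi eta)].

Fixpoint ar1 (d : measure_display) (T : measurableType d) (R : realType)
    (P : probability T R) (alpha : R) (xi : nat -> {RV P >-> R}) (n : nat)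
    (w : T) : R :=
  match n with
  | 0 => 0
  | m.+1 => alpha * ar1 alpha xi m w + xi m w
  end.

Definition Z12 (d : measure_display) (T : measurableType d) (R : realType)
    (P : probability T R) (alpha : R) (xi eta : nat -> {RV P >-> R}) (n : nat)
    (w : T) : R :=
  let X i := ar1 alpha xi i w in
  let Y i := ar1 alpha eta i w in
  1 / n%:R * (\sum_(1 <= i < n.+1) X i * Y i)
  - 1 / n%:R ^+ 2
    * (\sum_(1 <= i < n.+1) X i) * (\sum_(1 <= i < n.+1) Y i).

Section measurability.
Context (d : measure_display) (T : measurableType d) (R : realType)
  (P : probability T R) (alpha : R).
Implicit Types xi eta : nat -> {RV P >-> R}.

Lemma measurable_ar1 xi n : measurable_fun [set: T] (ar1 alpha xi n).
Proof.
elim: n => [|n IHn] /=; first exact: measurable_cst.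
by apply: measurable_funD => //; apply: measurable_funM.
Qed.

Lemma measurable_Z12 xi eta n : measurable_fun [set: T] (Z12 alpha xi eta n).
Proof.
apply: measurable_funB.
  apply: measurable_funM => //; apply: measurable_sum => i.
  by apply: measurable_funM; exact: measurable_ar1.
apply: measurable_funM; first apply: measurable_funM => //.
  by apply: measurable_sum => i; exact: measurable_ar1.
by apply: measurable_sum => i; exact: measurable_ar1.
Qed.

HB.instance Definition _ xi eta n :=
  isMeasurableFun.Build _ _ _ _ (Z12 alpha xi eta n) (measurable_Z12 xi eta n).

End measurability.

Definition dKol (R : realType)
    (d : measure_display) (T : measurableType d) (P : probability T R)
    (d' : measure_display) (T' : measurableType d') (P' : probability T' R)
    (X : {RV P >-> R}) (Y : {RV P' >-> R}) : \bar R :=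
  ereal_sup [set `|cdf X z - cdf Y z|%E | z in [set: R]].

(* Meaningful for integrable X and Y, so that 'E_P[f \o X] and 'E_P'[f \o Y]
   are finite for every Lipschitz f. *)
Definition dW (R : realType)
    (d : measure_display) (T : measurableType d) (P : probability T R)
    (d' : measure_display) (T' : measurableType d') (P' : probability T' R)
    (X : {RV P >-> R}) (Y : {RV P' >-> R}) : \bar R :=
  ereal_sup [set `|'E_P[f \o X] - 'E_P'[f \o Y]|%E
            | f in [set f : R -> R | 1.-lipschitz (f : R^o -> R^o)]].

(* Convergence in distribution to the law [mu]: the distribution functions
   converge at every continuity point of the distribution function of [mu]. *)
Definition cvg_in_distribution (d : measure_display) (T : measurableType d)
    (R : realType) (P : probability T R) (X : nat -> {RV P >-> R})
    (mu : probability (measurableTypeR R) R) : Prop :=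
  forall z : R, {for z, continuous (fun x : R => mu `]-oo, x]%classic)} ->
    cdf (X n) z @[n --> \oo] --> mu `]-oo, z]%classic.

Definition C2 (R : realType) (alpha : R) : R :=
  4 / (1 - alpha ^+ 2) ^+ 3
    * sup [set m%:R * alpha ^+ (2 * m + 2) | m in [set m : nat | (1 <= m)%N]]
  + (4 * alpha ^+ 2 + alpha ^+ 4) / (1 - alpha ^+ 2) ^+ 4
  + 8 / ((1 - alpha) ^+ 2 * (1 - alpha ^+ 2))
  + 16 * `|alpha|
      / ((1 - `|alpha|) * (1 - alpha) ^+ 2 * (1 - alpha ^+ 2))
  + 16 / (1 - alpha) ^+ 4.

Definition C3 (R : realType) (alpha : R) : R :=
  (2 `^ (4 / 3)
     / ((1 - alpha ^+ 2) `^ (4 / 3) * (1 - `|alpha| `^ (4 / 3)))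
   + 16 / (1 - alpha) `^ (8 / 3)) ^+ 3.

Definition C4 (R : realType) (alpha : R) : R :=
  (1 - alpha ^+ 2) ^+ 3 / (1 + alpha ^+ 2)
    * Num.sqrt (C2 alpha ^+ 2 + C3 alpha).

(* Main.v *)
(* Conditionally on the noise [eta], the rescaled covariance is a linear
   combination of the [xi i], hence a centred Gaussian variable with a random
   variance [S ^ 2], a quadratic form in [eta]. So its law is a Gaussian variance
   mixture, and no Stein equation is needed: both distances to the standard
   normal law are controlled by [E |1 - S ^ 2| <= sqrt (E (1 - S ^ 2) ^ 2)].
   With [M = A^T (I - J / n) A], where [A] is the triangular matrix of the powers
   of [alpha] and [J] the all-ones matrix, [E S ^ 2] and [Var S ^ 2] are multiples
   of the squared Frobenius norms of [M] and [M^T M].  The first is computed from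
   [A A^T], the covariance matrix of the process, up to the cost of centering;
   the second is at most [|M|_op ^ 2] times the first. *)

From HB Require Import structures.
Require Import Defs.
From mathcomp Require Import all_boot all_order all_algebra finmap ring lra.
From mathcomp Require Import all_classical all_reals all_analysis measurable_realfun.

Set Implicit Arguments.
Unset Strict Implicit.
Unset Printing Implicit Defensive.

Import Order.TTheory GRing.Theory Num.Theory.
Import numFieldNormedType.Exports.

Local Open Scope classical_set_scope.
Local Open Scope ring_scope.

(** * The standard normal law *)

Section gaussian.
Context {R : realType}.
Local Notation mu := (@lebesgue_measure R).
Local Notation gauss := (@normal_prob R 0 1).
Implicit Types (f : R -> \bar R) (m s x : R).

(** At a fixed variance both comparisons have the right constants: the distribution functions of
    [N(0, s ^ 2)] and [N(0, 1)] differ by at most [|1 - s ^ 2|], and coupling the two laws as [s x]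
    and [x] costs [|1 - s| E |x|], with [E |x| = sqrt (2 / pi)]. The difficulty is that [C2] and
    [C3] are prescribed. With [B = (1 + alpha ^ 2) / (1 - alpha ^ 2) ^ 3] and [D = n B - |M|_F ^ 2],
    the claim becomes [D ^ 2 + 2 |M^T M|_F ^ 2 <= n (C2 ^ 2 + C3)]. Here [D <= C2], but the operator
    norm estimate [2 |M^T M|_F ^ 2 <= 2 n B / (1 - |alpha|) ^ 4] cannot be paid by [n C3] alone: as
    [alpha] tends to [-1], [2 B / (1 - |alpha|) ^ 4] grows like [1 / 2] times [(1 - |alpha|) ^ -7],
    and [C3] like [27 / 64] times the same power. The excess is charged to [n C2 ^ 2]: one copy of
    [C2 ^ 2] covers [D ^ 2], and [n - 1] copies are left. *)

Lemma ge0_integral_normal_prob m s f :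
  measurable_fun [set: R] f -> (forall x, (0 <= f x)%E) ->
  (\int[normal_prob m s]_x f x = \int[mu]_x (f x * (normal_pdf m s x)%:E))%E.
Proof.
move=> mf f0.
have dom := normal_prob_dominates m s.
rewrite -(Radon_Nikodym_SigmaFinite.change_of_variables dom)//.
apply: ae_eq_integral => //.
- apply: emeasurable_funM => //; apply: (measurable_int mu).
  exact: Radon_Nikodym_SigmaFinite.f_integrable.
- apply: emeasurable_funM => //.
  by apply/measurable_EFinP; exact: measurable_normal_pdf.
- apply: ae_eqe_mul2l; apply: integral_ae_eq => //=.
  + exact: Radon_Nikodym_SigmaFinite.f_integrable.
  + by apply/measurable_EFinP; exact: measurable_normal_pdf.
  + by move=> E _ mE; rewrite -Radon_Nikodym_SigmaFinite.f_integral.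
Qed.

(** The pushforward of Lebesgue measure under [x -> k x + m], multiplied by [k], gives half-open
    intervals their length, so it is Lebesgue measure by uniqueness. *)
Lemma ge0_integral_lebesgue_affine (k : R) m f : 0 < k ->
  measurable_fun [set: R] f -> (forall x, (0 <= f x)%E) ->
  (\int[mu]_x f x = k%:E * \int[mu]_x f (k * x + m)%R)%E.
Proof.
move=> k0 mf f0.
pose phi x : measurableTypeR R := k * x + m.
have mphi : measurable_fun [set: R] phi.
  by apply: measurable_funD => //; apply: measurable_funM.
have kge0 : 0 <= k by exact: ltW.
pose pf : {measure set (measurableTypeR R) -> \bar R} :=
  measure_function_pushforward__canonical__measure_function_Measure mu mphi.
pose nu : {measure set (measurableTypeR R) -> \bar R} :=
  mscale (NngNum kge0) pf.
have nuE A : measurable A -> mu A = nu A.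
  move=> mA; apply: (@lebesgue_measure_unique R nu) => //= _ [[a b]] _ <-.
  rewrite /nu/= /mscale/= /pushforward.
  have -> : phi @^-1` `]a, b] = `](a - m) / k, (b - m) / k]%classic.
    apply/seteqP; split => x /=; rewrite !in_itv/= /phi.
      by rewrite ltr_pdivrMr// ler_pdivlMr// ltrBlDr lerBrDr mulrC.
    by rewrite ltr_pdivrMr// ler_pdivlMr// ltrBlDr lerBrDr mulrC.
  rewrite !lebesgue_measure_itv/= !lte_fin ltr_pM2r ?invr_gt0// ltrD2r.
  case: ifPn => ab; last by rewrite mule0.
  by rewrite -!EFinB -EFinM; congr EFin; field; rewrite gt_eqF.
rewrite (eq_measure_integral nu); last by move=> A mA _; exact: nuE.
rewrite ge0_integral_mscale//=; congr (_ * _)%E.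
by rewrite ge0_integral_pushforward.
Qed.

Lemma ge0_integral_normal_affine m s f : 0 < s ->
  measurable_fun [set: R] f -> (forall x, (0 <= f x)%E) ->
  (\int[normal_prob m s]_x f x = \int[gauss]_x f (s * x + m)%R)%E.
Proof.
move=> s0 mf f0.
have ms : measurable_fun [set: R] (fun x => s * x + m).
  by apply: measurable_funD => //; apply: measurable_funM.
have mpdf m' s' : measurable_fun [set: R] (fun x => (normal_pdf m' s' x)%:E).
  by apply/measurable_EFinP; exact: measurable_normal_pdf.
pose g x := f (s * x + m).
have mg : measurable_fun [set: R] g by exact: (measurableT_comp mf ms).
have g0 x : (0 <= g x)%E by exact: f0.
rewrite (ge0_integral_normal_prob _ _ mf f0) .
rewrite [RHS](ge0_integral_normal_prob 0 1 mg g0).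
rewrite (ge0_integral_lebesgue_affine m s0)//; last 2 first.
- exact: emeasurable_funM.
- by move=> x; rewrite mule_ge0 ?lee_fin ?normal_pdf_ge0.
rewrite -ge0_integralZl ?ltW//; last 2 first.
- apply: emeasurable_funM; first exact: mg.
  exact: (measurableT_comp (mpdf m s) ms).
- by move=> x _; rewrite mule_ge0 ?lee_fin ?normal_pdf_ge0.
apply: eq_integral => x _; rewrite muleCA; congr (_ * _)%E.
rewrite -EFinM; congr EFin.
rewrite !normal_pdfE ?gt_eqF//= /normal_peak /normal_fun mulrA; congr (_ * expR _).
  rewrite expr1n mul1r -mulrnAr sqrtrM ?sqr_ge0// sqrtr_sqr gtr0_norm// invfM.
  by rewrite mulrA divff ?mul1r// gt_eqF.
by field; rewrite gt_eqF.
Qed.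

Lemma ge0_integral_gaussN f :
  measurable_fun [set: R] f -> (forall x, (0 <= f x)%E) ->
  (\int[gauss]_x f x = \int[gauss]_x f (- x)%R)%E.
Proof.
move=> mf f0.
have mpdf : measurable_fun [set: R] (fun x => (normal_pdf 0 1 x)%:E).
  by apply/measurable_EFinP; exact: measurable_normal_pdf.
have mN : measurable_fun [set: R] (-%R : R -> measurableTypeR R) by [].
pose g x := f (- x).
have mg : measurable_fun [set: R] g by exact: (measurableT_comp mf mN).
have g0 x : (0 <= g x)%E by exact: f0.
rewrite (ge0_integral_normal_prob _ _ mf f0).
rewrite [RHS](ge0_integral_normal_prob 0 1 mg g0).
transitivity (\int[pushforward mu (-%R : R -> measurableTypeR R)]_x
    (f x * (normal_pdf 0 1 x)%:E))%E.
  by apply: eq_measure_integral => A mA _; exact/esym/lebesgue_measureN.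
rewrite ge0_integral_pushforward; last 4 first.
- by [].
- exact: measurableT.
- exact: emeasurable_funM.
- by move=> x _; rewrite mule_ge0 ?lee_fin ?normal_pdf_ge0.
rewrite preimage_setT; apply: eq_integral => x _ /=; congr (_ * _%:E)%E.
by rewrite !normal_pdfE// /normal_fun !subr0 sqrrN.
Qed.

End gaussian.

(** * Stability of the normal law under linear combinations *)

Section gaussian_stability.
Context {R : realType}.
Local Notation mu := (@lebesgue_measure R).
Local Notation gauss := (@normal_prob R 0 1).
Implicit Types (f : R -> \bar R) (m s x : R).

Lemma integral_gauss_cst (c : \bar R) : (\int[gauss]_x c = c)%E.
Proof.
rewrite integral_cst//.
by rewrite [X in (_ * X)%E](_ : _ = 1%E) ?mule1//; exact: integral_normal_pdf.
Qed.

(* Completing the square in [x]. *)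
Lemma normal_pdf_mixture (a b u x : R) : 0 < b ->
  let r := Num.sqrt (a ^+ 2 + b ^+ 2) in
  normal_pdf (a * x) b u * normal_pdf 0 1 x
  = normal_pdf 0 r u * normal_pdf (a * u / r ^+ 2) (b / r) x.
Proof.
move=> b0 r.
have c0 : 0 < a ^+ 2 + b ^+ 2 by rewrite ltr_wpDl ?sqr_ge0 ?exprn_gt0.
have r0 : 0 < r by rewrite sqrtr_gt0.
have r2 : r ^+ 2 = a ^+ 2 + b ^+ 2 by rewrite sqr_sqrtr ?ltW.
have pi0 := pi_gt0 R.
rewrite !normal_pdfE ?gt_eqF ?divr_gt0//= /normal_peak /normal_fun.
rewrite mulrACA [RHS]mulrACA -!invfM -!sqrtrM; last 2 first.
- by rewrite mulrn_wge0// mulr_ge0 ?sqr_ge0 ?ltW.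
- by rewrite mulrn_wge0// mulr_ge0 ?sqr_ge0 ?ltW.
congr ((Num.sqrt _)^-1 * _).
  by field; rewrite gt_eqF.
rewrite -!expRD; congr expR.
rewrite -r2 in c0.
rewrite expr1n subr0.
have -> : (b / r) ^+ 2 = b ^+ 2 / r ^+ 2 by rewrite expr_div_n.
rewrite r2; field.
by rewrite -r2 !gt_eqF ?exprn_gt0.
Qed.

Lemma measurable_normal_pdf_pair (a b : R) : 0 < b ->
  measurable_fun [set: R * R] (fun z : R * R => normal_pdf (a * z.1) b z.2).
Proof.
move=> b0.
under eq_fun do rewrite normal_pdfE ?gt_eqF// /normal_fun.
apply: measurable_funM => //; apply: measurableT_comp => //.
apply: measurable_funM => //; apply: measurableT_comp => //.
apply: measurable_funX; apply: measurable_funB => //.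
exact: measurable_funM.
Qed.

(** Since [b > 0], the inner law has a density in [u = a x + b y]. After Tonelli,
    [normal_pdf_mixture] splits the joint density into the density of [u] and a normal density in
    [x], which integrates to [1]. *)
Lemma ge0_integral_gauss_stable_gt0 (a b : R) f : 0 < b ->
  measurable_fun [set: R] f -> (forall x, (0 <= f x)%E) ->
  (\int[gauss]_x \int[gauss]_y f (a * x + b * y)%R
   = \int[gauss]_x f (Num.sqrt (a ^+ 2 + b ^+ 2) * x)%R)%E.
Proof.
move=> b0 mf f0; set r := Num.sqrt _.
have r0 : 0 < r by rewrite sqrtr_gt0 ltr_wpDl ?sqr_ge0 ?exprn_gt0.
pose h x := (\int[mu]_u (f u * (normal_pdf (a * x) b u)%:E))%E.
have hE x : (\int[gauss]_y f (a * x + b * y)%R = h x)%E.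
  rewrite /h -(ge0_integral_normal_prob (a * x) b mf f0).
  rewrite (ge0_integral_normal_affine (a * x) b0 mf f0).
  by apply: eq_integral => y _; rewrite addrC.
under eq_integral do rewrite hE.
have mk : measurable_fun [set: R * R]
    (fun z : R * R => f z.2 * (normal_pdf (a * z.1) b z.2)%:E)%E.
  apply: emeasurable_funM; first exact: measurableT_comp.
  by apply/measurable_EFinP; exact: measurable_normal_pdf_pair.
have k0 (z : R * R) : (0 <= f z.2 * (normal_pdf (a * z.1) b z.2)%:E)%E.
  by rewrite mule_ge0// lee_fin normal_pdf_ge0.
have mh : measurable_fun [set: R] h.
  exact: (@measurable_fun_fubini_tonelli_F _ _ _ _ _ mu
    (fun z : R * R => f z.2 * (normal_pdf (a * z.1) b z.2)%:E)%E).
have h0 x : (0 <= h x)%E by apply: integral_ge0 => u _; exact: (k0 (x, u)).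
have mpdf m s : measurable_fun [set: R] (fun x => (normal_pdf m s x)%:E).
  by apply/measurable_EFinP; exact: measurable_normal_pdf.
rewrite (ge0_integral_normal_prob 0 1 mh h0).
under eq_integral => x _.
  rewrite -ge0_integralZr; last 4 first.
  - exact: measurableT.
  - apply: emeasurable_funM => //; exact: mpdf.
  - by move=> u _; exact: (k0 (x, u)).
  - by rewrite lee_fin normal_pdf_ge0.
  over.
pose g (z : R * R) :=
  (f z.2 * (normal_pdf (a * z.1) b z.2)%:E * (normal_pdf 0 1 z.1)%:E)%E.
have mg : measurable_fun [set: R * R] g.
  apply: emeasurable_funM; first exact: mk.
  exact: (measurableT_comp (mpdf 0 1)).
have g0 z : (0 <= g z)%E by rewrite mule_ge0 ?k0 ?lee_fin ?normal_pdf_ge0.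
rewrite (@fubini_tonelli _ _ _ _ _ mu mu g mg g0).
transitivity (\int[normal_prob 0 r]_x f x)%E; last first.
  rewrite (ge0_integral_normal_affine 0 r0 mf f0).
  by apply: eq_integral => x _; rewrite !addr0.
rewrite (ge0_integral_normal_prob 0 r mf f0).
apply: eq_integral => u _; rewrite /g/=.
under eq_integral => x _.
  rewrite -muleA -EFinM normal_pdf_mixture// -/r EFinM muleA.
  over.
rewrite ge0_integralZl.
- by rewrite integral_normal_pdf mule1.
- exact: measurableT.
- exact: mpdf.
- by move=> x _; rewrite lee_fin normal_pdf_ge0.
- by rewrite mule_ge0// lee_fin normal_pdf_ge0.
Qed.

Lemma ge0_integral_gauss_stable (a b : R) f :
  measurable_fun [set: R] f -> (forall x, (0 <= f x)%E) ->
  (\int[gauss]_x \int[gauss]_y f (a * x + b * y)%R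
   = \int[gauss]_x f (Num.sqrt (a ^+ 2 + b ^+ 2) * x)%R)%E.
Proof.
move=> mf f0.
have [b0|b0|->] := ltgtP b 0; last 1 first.
- under eq_integral => x _.
    under eq_integral do rewrite mul0r addr0.
    rewrite integral_gauss_cst.
    over.
  rewrite expr0n addr0 sqrtr_sqr.
  have [a0|a0] := ltP a 0; last by rewrite ger0_norm.
  rewrite ltr0_norm// ge0_integral_gaussN; last 2 first.
  - exact: (measurableT_comp mf (mulrl_measurable _)).
  - by [].
  by apply: eq_integral => x _; rewrite mulrNN.
- have Nb0 : 0 < - b by rewrite oppr_gt0.
  rewrite -(sqrrN b) -(ge0_integral_gauss_stable_gt0 a Nb0 mf f0).
  apply: eq_integral => x _; rewrite ge0_integral_gaussN; last 2 first.
  - apply: (measurableT_comp mf).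
    by apply: measurable_funD => //; exact: mulrl_measurable.
  - by [].
  by apply: eq_integral => y _; rewrite mulrN mulNr.
- exact: ge0_integral_gauss_stable_gt0.
Qed.

End gaussian_stability.

(** * First absolute moment and variance of the standard normal law *)

Section gaussian_moments.
Context {R : realType}.
Local Notation mu := (@lebesgue_measure R).
Local Notation gauss := (@normal_prob R 0 1).
Local Notation phi := (@normal_pdf R 0 1).

Lemma normal_pdf01E (x : R) :
  phi x = normal_peak 1 * expR (- (x ^+ 2 / 2)).
Proof. by rewrite normal_pdfE//= /normal_fun subr0 expr1n mulNr. Qed.

Lemma is_derive_normal_pdf01 (x : R) : is_derive x 1 phi (- (x * phi x)).
Proof.
have -> : phi = fun x => normal_peak 1 * expR (- (x ^+ 2 / 2)).
  by apply/funext => y; rewrite normal_pdf01E.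
apply: is_derive_eq.
rewrite /GRing.scale/= !(mulr0, scale0r, addr0, add0r, mulr1).
by field.
Qed.

Lemma cvg_normal_pdf01 : phi x @[x --> +oo%R] --> (0 : R).
Proof.
rewrite (_ : phi = fun x => normal_peak 1 * gauss_fun (x * (Num.sqrt 2)^-1)).
  rewrite -(mulr0 (normal_peak 1)); apply: cvgMr.
  apply: (cvg_comp _ (@gauss_fun R)); last exact: cvg_gauss_fun.
  by apply: gt0_cvgMly; rewrite ?invr_gt0 ?sqrtr_gt0//; exact: cvg_id.
apply/funext => x; rewrite normal_pdf01E /gauss_fun; congr (_ * expR (- _)).
by rewrite exprMn exprVn sqr_sqrtr.
Qed.

Lemma integral_tail_gauss1 (u : R) : 0 <= u ->
  (\int[mu]_(x in `[u, +oo[) (x * phi x)%:E = (phi u)%:E)%E.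
Proof.
move=> u0.
have c1 : continuous phi by exact: continuous_normal_pdf.
have -> : phi u = 0 - - phi u by rewrite sub0r opprK.
rewrite EFinB; apply: (@ge0_continuous_FTC2y _ _ (fun x => - phi x)).
- by move=> x ux; rewrite mulr_ge0 ?normal_pdf_ge0// (le_trans u0).
- apply: continuous_subspaceT => x; apply: cvgM; first exact: cvg_id.
  exact: c1.
- by have := cvgN cvg_normal_pdf01; rewrite oppr0; apply.
- by move=> x ux; have := is_derive_normal_pdf01 x => ?; exact: derivableN.
- by apply: cvgN; apply: cvg_at_right_filter; exact: c1.
- move=> x _; rewrite derive1E.
  have := is_derive_normal_pdf01 x => ?.
  by rewrite deriveN// derive_val opprK.
Qed.

Lemma integral_gauss_norm :
  (\int[gauss]_x (`|x|)%:E = (Num.sqrt (2 / pi))%:E)%E.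
Proof.
rewrite ge0_integral_normal_prob; last 2 first.
- by apply/measurable_EFinP; exact: normr_measurable.
- by move=> x; rewrite lee_fin.
under eq_integral do rewrite -EFinM.
rewrite (@ge0_symfun_integralT _ (fun x => `|x| * phi x)); last 3 first.
- by move=> x; rewrite mulr_ge0 ?normal_pdf_ge0.
- move=> x; apply: cvgM; first exact: norm_continuous.
  exact: continuous_normal_pdf.
- by move=> x; rewrite /= normrN !normal_pdf01E sqrrN.
rewrite (_ : [set x | 0 <= x] = `[0, +oo[%classic); last first.
  by apply/seteqP; split => x /=; rewrite in_itv/= andbT.
under eq_integral => x.
  rewrite inE/= in_itv/= andbT => x0; rewrite ger0_norm//.
  over.
rewrite integral_tail_gauss1// -EFinM; congr EFin.
rewrite normal_pdf01E expr0n/= mul0r oppr0 expR0 mulr1 /normal_peak.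
have pi0 := pi_gt0 R.
have s2 : Num.sqrt 2 != 0 :> R by rewrite sqrtr_eq0 -ltNge.
have sp : Num.sqrt pi != 0 :> R by rewrite sqrtr_eq0 -ltNge.
have -> : Num.sqrt (2 / pi) = Num.sqrt 2 / Num.sqrt pi :> R.
  by rewrite sqrtrM// sqrtrV// ltW.
have -> : Num.sqrt (1 ^+ 2 * pi *+ 2) = Num.sqrt pi * Num.sqrt 2 :> R.
  by rewrite expr1n mul1r -mulr_natr sqrtrM ?ltW.
have e2 : 2 = Num.sqrt 2 ^+ 2 :> R by rewrite sqr_sqrtr.
transitivity (Num.sqrt 2 ^+ 2 / (Num.sqrt pi * Num.sqrt 2) : R).
  by rewrite -e2.
by field; rewrite s2 sp.
Qed.

(* Writing [phi u] as the tail integral of [x * phi x], Tonelli turns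
   [int phi = 1] into [int x ^ 2 phi = 1]. *)
Lemma integral_gauss_sqr : (\int[gauss]_x (x ^+ 2)%:E = 1)%E.
Proof.
have cphi : continuous phi by exact: continuous_normal_pdf.
have phiN x : phi (- x) = phi x by rewrite !normal_pdf01E sqrrN.
have hset : [set x : R | 0 <= x] = `[0, +oo[%classic.
  by apply/seteqP; split => x /=; rewrite in_itv/= andbT.
rewrite ge0_integral_normal_prob; last 2 first.
- by apply/measurable_EFinP; exact: exprn_measurable.
- by move=> x; rewrite lee_fin sqr_ge0.
under eq_integral do rewrite -EFinM.
rewrite (@ge0_symfun_integralT _ (fun x => x ^+ 2 * phi x)); last 3 first.
- by move=> x; rewrite mulr_ge0 ?normal_pdf_ge0 ?sqr_ge0.
- move=> x; apply: cvgM; first exact: exprn_continuous.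
  exact: cphi.
- by move=> x; rewrite /= phiN sqrrN.
rewrite -(@integral_normal_pdf R 0 1).
rewrite [RHS](@ge0_symfun_integralT _ phi); last 3 first.
- by move=> x; rewrite normal_pdf_ge0.
- exact: cphi.
- by move=> x; rewrite /= phiN.
rewrite hset; congr (_ * _)%E.
pose g (z : R * R) : \bar R :=
  if (0 <= z.1) && (z.1 <= z.2) then (z.2 * phi z.2)%:E else 0%E.
have g0 z : (0 <= g z)%E.
  rewrite /g; case: ifP => // /andP[z0 z1].
  by rewrite lee_fin mulr_ge0 ?normal_pdf_ge0// (le_trans z0).
have mg : measurable_fun [set: R * R] g.
  apply: measurable_fun_ifT => //.
    by apply: measurable_and; apply: measurable_fun_ler.
  apply/measurable_EFinP; apply: measurable_funM => //.
  exact: (measurableT_comp (measurable_normal_pdf _ _)).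
have swap := @fubini_tonelli _ _ _ _ _ mu mu g mg g0.
transitivity (\int[mu]_x \int[mu]_u g (u, x))%E; last first.
  rewrite -swap [RHS]integral_mkcond; apply: eq_integral => u _.
  rewrite patchE; case: ifPn => [|/negP].
    rewrite inE/= in_itv/= andbT => u0.
    transitivity (\int[mu]_(x in `[u, +oo[) (x * phi x)%:E)%E; last first.
      exact: integral_tail_gauss1.
    rewrite [RHS]integral_mkcond.
    apply: eq_integral => x _; rewrite patchE /g/= u0/=.
    by rewrite mem_setE in_itv/= andbT.
  rewrite inE/= in_itv/= andbT => /negP u0.
  by under eq_integral do rewrite /g/= (negbTE u0)/=; rewrite integral0.
rewrite [LHS]integral_mkcond; apply: eq_integral => x _.
rewrite patchE mem_setE in_itv/= andbT; case: ifPn => x0.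
  transitivity (\int[mu]_(u in `[0%R, x]) (x * phi x)%:E)%E.
    transitivity ((x * phi x)%:E * mu `[0%R, x])%E; last first.
      by apply/esym; apply: integral_cst; exact: measurable_itv.
    rewrite lebesgue_measure_itv/= lte_fin.
    move: x0; rewrite le_eqVlt => /predU1P[<-|x0].
      by rewrite ltxx mule0 expr0n mul0r.
    by rewrite x0 oppr0 adde0 -EFinM mulrAC.
  rewrite [LHS]integral_mkcond; apply: eq_integral => u _.
  by rewrite patchE mem_setE in_itv.
apply/esym; apply: integral0_eq => u _; rewrite /g/=.
case: ifPn => [/andP[u0 ux]|_]; last by [].
by rewrite (le_trans u0 ux) in x0.
Qed.

End gaussian_moments.

(** Unlike a single [L^p] space, this class is an algebra: every polynomial in the noises is
    integrable without any bookkeeping of exponents. *)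
Definition all_moments (d : measure_display) (T : measurableType d)
    (R : realType) (P : probability T R) (f : T -> R) : Prop :=
  measurable_fun [set: T] f /\
  forall p : nat, P.-integrable [set: T] (EFin \o (fun x => f x ^+ p)).

Section all_moments.
Context (d : measure_display) (T : measurableType d) (R : realType)
  (P : probability T R).
Implicit Types f g : T -> R.

Lemma all_moments_integrable f :
  all_moments P f -> P.-integrable [set: T] (EFin \o f).
Proof. by case=> _ /(_ 1). Qed.

Lemma all_moments_cst (c : R) : all_moments P (fun=> c).
Proof.
split; first exact: measurable_cst.
by move=> p; exact: finite_measure_integrable_cst.
Qed.

Lemma all_momentsD f g : all_moments P f -> all_moments P g ->
  all_moments P (fun x => f x + g x).
Proof.
move=> [mf If] [mg Ig]; split; first exact: measurable_funD.
move=> p; have Ifp := integrable_norm (If p); have Igp := integrable_norm (Ig p).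
have Is := integrableZl measurableT (2 ^+ p) (integrableD measurableT Ifp Igp).
apply: le_integrable Is => //.
  by apply/measurable_EFinP/measurable_funX/measurable_funD.
move=> x _ /=; rewrite lee_fin [leRHS]ger0_norm; last first.
  by rewrite mulr_ge0 ?addr_ge0 ?exprn_ge0.
rewrite !normrX (le_trans (lerXn2r _ _ _ (ler_normD _ _)))//.
  by rewrite nnegrE addr_ge0.
wlog fg : f g {mf If mg Ig Ifp Igp} / `|f x| <= `|g x|.
  move=> H; case: (leP `|f x| `|g x|) => [|/ltW] gf; first exact: H.
  by rewrite (addrC `|f x|) (addrC (`|f x| ^+ p)); exact: H.
apply: (@le_trans _ _ ((2 * `|g x|) ^+ p)).
  by rewrite lerXn2r ?nnegrE ?addr_ge0 ?mulr_ge0// mulr2n mulrDl mul1r lerD2r.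
by rewrite exprMn ler_wpM2l ?exprn_ge0// lerDr exprn_ge0.
Qed.

(** From [|f g| ^ p <= f ^ (2 p) + g ^ (2 p)]: a product doubles the exponent, which is why moments
    of every order are demanded at once. *)
Lemma all_momentsM f g : all_moments P f -> all_moments P g ->
  all_moments P (fun x => f x * g x).
Proof.
move=> [mf If] [mg Ig]; split; first exact: measurable_funM.
move=> p; have Is := integrableD measurableT (If (p * 2)%N) (Ig (p * 2)%N).
apply: le_integrable Is => //.
  by apply/measurable_EFinP/measurable_funX/measurable_funM.
move=> x _ /=; rewrite lee_fin exprMn !exprM.
rewrite [leRHS]ger0_norm ?addr_ge0 ?sqr_ge0// normrM.
rewrite -(real_normK (num_real (f x ^+ p))) -(real_normK (num_real (g x ^+ p))).
move: (`|f x ^+ p|) (`|g x ^+ p|) (normr_ge0 (f x ^+ p)) (normr_ge0 (g x ^+ p)).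
by move=> u v u0 v0; nra.
Qed.

Lemma all_momentsX f n : all_moments P f -> all_moments P (fun x => f x ^+ n).
Proof.
move=> hf; elim: n => [|n IHn]; first exact: all_moments_cst.
by under eq_fun do rewrite exprS; exact: all_momentsM.
Qed.

Lemma all_momentsN f : all_moments P f -> all_moments P (fun x => - f x).
Proof.
move=> hf; under eq_fun do rewrite -mulN1r.
by apply: all_momentsM => //; exact: all_moments_cst.
Qed.

Lemma all_moments_sum (I : Type) (r : seq I) (p : pred I) (f : I -> T -> R) :
  (forall i, p i -> all_moments P (f i)) ->
  all_moments P (fun x => \sum_(i <- r | p i) f i x).
Proof.
move=> hf; elim: r => [|i r IHr].
  by under eq_fun do rewrite big_nil; exact: all_moments_cst.
have [pi|npi] := boolP (p i).
  under eq_fun do rewrite big_cons pi.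
  by apply: all_momentsD => //; exact: hf.
by under eq_fun do rewrite big_cons (negbTE npi).
Qed.

Lemma integral_EFin_Rintegral f : P.-integrable [set: T] (EFin \o f) ->
  (\int[P]_x (f x)%:E)%E = (\int[P]_x f x)%:E.
Proof. by move=> If; rewrite fineK//; exact: integrable_fin_num. Qed.

Lemma RintegralT_cst (c : R) : \int[P]_x c = c.
Proof.
by rewrite Rintegral_cst//= [X in fine X](_ : _ = 1%E) ?mulr1// probability_setT.
Qed.

Lemma RintegralT_D f g : all_moments P f -> all_moments P g ->
  \int[P]_x (f x + g x) = \int[P]_x f x + \int[P]_x g x.
Proof. by move=> hf hg; rewrite RintegralD//; exact: all_moments_integrable. Qed.

Lemma RintegralT_Z (c : R) f : all_moments P f ->
  \int[P]_x (c * f x) = c * \int[P]_x f x.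
Proof. by move=> hf; rewrite RintegralZl//; exact: all_moments_integrable. Qed.

(* From [2 c |f| <= c ^ 2 + f ^ 2] with [c = E |f|]. *)
Lemma Rintegral_norm_le_sqrt f : all_moments P f ->
  \int[P]_x `|f x| <= Num.sqrt (\int[P]_x f x ^+ 2).
Proof.
move=> hf; set s2 := \int[P]_x f x ^+ 2; set s := Num.sqrt _.
have If := integrable_norm (all_moments_integrable hf).
have If2 := all_moments_integrable (all_momentsX 2 hf).
have s20 : 0 <= s2 by apply: Rintegral_ge0 => x _; exact: sqr_ge0.
set m := \int[P]_x `|f x|.
have m0 : 0 <= m by apply: Rintegral_ge0 => x _; exact: normr_ge0.
have mE (c : R) : 2 * c * m <= c ^+ 2 + s2.
  have -> : c ^+ 2 + s2 = \int[P]_x (c ^+ 2 + f x ^+ 2).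
    rewrite RintegralT_D ?RintegralT_cst//; last exact: all_momentsX.
    exact: all_moments_cst.
  rewrite /m -RintegralZl//; apply: le_Rintegral => //.
  - exact: (integrableZl measurableT (2 * c) If).
  - apply: all_moments_integrable; apply: all_momentsD.
      exact: all_moments_cst.
    exact: all_momentsX.
  - move=> x _; rewrite -(real_normK (num_real (f x))).
    by have := sqr_ge0 (c - `|f x|); nra.
have m2 : m ^+ 2 <= s2 by have := mE m; nra.
by rewrite -(ger0_norm m0) -sqrtr_sqr ler_sqrt.
Qed.

End all_moments.

(** * Higher moments of the standard normal law *)

Section gaussian_all_moments.
Context {R : realType}.
Local Notation mu := (@lebesgue_measure R).
Local Notation gauss :=
  (@normal_prob R 0 1 : probability (measurableTypeR R) R).

(** Completing the square, [exp x] times the standard density is [exp (1 / 2)] times the density of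
    [N(1, 1)]. *)
Lemma integrable_expR_gauss : gauss.-integrable [set: R] (EFin \o expR).
Proof.
have mexp : measurable_fun [set: R] (EFin \o @expR R).
  by apply/measurable_EFinP; exact: measurable_expR.
apply/integrableP; split => //.
under eq_integral do rewrite /= ger0_norm ?expR_ge0//.
rewrite ge0_integral_normal_prob; last 2 first.
- exact: mexp.
- by move=> x; rewrite lee_fin expR_ge0.
have -> : (\int[mu]_x ((expR x)%:E * (normal_pdf 0 1 x)%:E) =
  \int[mu]_x ((expR (2^-1))%:E * (normal_pdf 1 1 x)%:E))%E.
  apply: eq_integral => x _; rewrite -!EFinM; congr EFin.
  rewrite !normal_pdfE//= mulrCA [RHS]mulrCA; congr (_ * _).
  by rewrite /normal_fun -!expRD; congr expR; field.
rewrite integralZl//; last exact: integrable_normal_pdf.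
by rewrite integral_normal_pdf mule1 ltry.
Qed.

(** Domination by exponentials: [|x| ^ p <= p! exp |x| <= p! (exp x + exp (- x))]. *)
Lemma all_moments_gauss : all_moments gauss (fun x => x).
Proof.
split=> // p.
have Ie := integrable_expR_gauss.
have IeN : gauss.-integrable [set: R] (EFin \o (fun x => expR (- x))).
  have mN : measurable_fun [set: R] (fun x : R => expR (- x)).
    by apply: measurableT_comp.
  apply/integrableP; split; first exact/measurable_EFinP.
  have /integrableP[mexp] := Ie; rewrite ge0_integral_gaussN//.
  exact: measurableT_comp.
have Is := integrableZl measurableT (p`!%:R) (integrableD measurableT Ie IeN).
apply: le_integrable Is => //.
  by apply/measurable_EFinP; exact: exprn_measurable.
move=> x _ /=; rewrite lee_fin [leRHS]ger0_norm; last first.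
  by rewrite mulr_ge0 ?addr_ge0 ?expR_ge0.
rewrite normrX.
apply: (@le_trans _ _ (p`!%:R * expR `|x|)).
  case: p => [|p].
    by rewrite expr0 mul1r (le_trans _ (expR_ge1Dx _))// lerDl.
  rewrite mulrC -ler_pdivrMr ?ltr0n ?fact_gt0//.
  by apply: le_trans (expR_ge1Dxn p (normr_ge0 x)); rewrite lerDr.
rewrite ler_wpM2l//; case: (leP 0 x) => x0.
  by rewrite ger0_norm// lerDl expR_ge0.
by rewrite ltr0_norm// lerDr expR_ge0.
Qed.

(** The reflection [x -> - x] preserves the law and exchanges the positive and negative parts of
    [f]. *)
Lemma Rintegral_gauss_odd (f : R -> R) : all_moments gauss f ->
  (forall x, f (- x) = - f x) -> \int[gauss]_x f x = 0.
Proof.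
move=> hf fN; have If := all_moments_integrable hf.
rewrite /Rintegral integralE.
rewrite [X in (X - _)%E](_ : _ = \int[gauss]_x ((EFin \o f)^\- x))%E.
  rewrite subee//; exact: integrable_neg_fin_num.
rewrite ge0_integral_gaussN; last 2 first.
- by apply: measurable_funepos; case/integrableP : If.
- by move=> x; rewrite funepos_ge0.
by apply: eq_integral => x _; rewrite funeposE funenegE/= fN.
Qed.

Lemma Rintegral_gauss_id : \int[gauss]_x x = 0.
Proof. by apply: Rintegral_gauss_odd => //; exact: all_moments_gauss. Qed.

Lemma Rintegral_gauss_sqr : \int[gauss]_x x ^+ 2 = 1.
Proof. by rewrite /Rintegral integral_gauss_sqr. Qed.

Lemma Rintegral_gauss_cube : \int[gauss]_x x ^+ 3 = 0.
Proof.
apply: Rintegral_gauss_odd => [|x]; first exact/all_momentsX/all_moments_gauss.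
by rewrite !exprS expr0; ring.
Qed.

(* For independent [x], [y], [(x + y) ^ 4] has the law of [4 x ^ 4], and
   expanding gives [2 m + 6 = 4 m]. *)
Lemma Rintegral_gauss_fourth : \int[gauss]_x x ^+ 4 = 3.
Proof.
set m := \int[gauss]_x x ^+ 4.
have hX k : all_moments gauss (fun x => x ^+ k).
  exact/all_momentsX/all_moments_gauss.
have hZ c k : all_moments gauss (fun x => c * x ^+ k).
  by apply: all_momentsM; [exact: all_moments_cst|exact: hX].
have hC c : all_moments gauss (fun=> c) by exact: all_moments_cst.
have mX : measurable_fun [set: R] (fun x : R => (x ^+ 4)%:E).
  by apply/measurable_EFinP; exact: exprn_measurable.
have X0 x : (0 <= (x ^+ 4)%:E :> \bar R)%E by rewrite lee_fin exprn_even_ge0.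
have := ge0_integral_gauss_stable 1 1 mX X0.
have -> : (\int[gauss]_x ((Num.sqrt (1 ^+ 2 + 1 ^+ 2) * x) ^+ 4)%:E
    = (4 * m)%:E)%E.
  rewrite -RintegralT_Z// -integral_EFin_Rintegral; last first.
    exact: all_moments_integrable.
  apply: eq_integral => x _; congr EFin; rewrite exprMn; congr (_ * _).
  rewrite expr1n (exprM _ 2 2) sqr_sqrtr; last by rewrite addr_ge0.
  by ring.
under eq_integral => x _.
  rewrite (_ : \int[gauss]_y _ = (x ^+ 4 + (6 * x ^+ 2 + m))%:E)%E; last first.
    transitivity (\int[gauss]_y (x ^+ 4 + (4 * x ^+ 3 * y ^+ 1 +
        (6 * x ^+ 2 * y ^+ 2 + (4 * x * y ^+ 3 + y ^+ 4))))%:E)%E.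
      apply: eq_integral => y _; congr EFin.
      by rewrite !exprS expr0; ring.
    rewrite integral_EFin_Rintegral; last first.
      apply: all_moments_integrable.
      by do 4 (apply: all_momentsD => //).
    congr EFin; rewrite RintegralT_D//; last by do 3 (apply: all_momentsD => //).
    rewrite RintegralT_D//; last by do 2 (apply: all_momentsD => //).
    rewrite RintegralT_D//; last by apply: all_momentsD.
    rewrite RintegralT_D// !RintegralT_Z// RintegralT_cst.
    rewrite Rintegral_gauss_id Rintegral_gauss_sqr Rintegral_gauss_cube.
    by rewrite -/m; ring.
  over.
rewrite integral_EFin_Rintegral; last first.
  by apply: all_moments_integrable; do 2 (apply: all_momentsD => //).
rewrite RintegralT_D//; last by apply: all_momentsD.
rewrite RintegralT_D// RintegralT_Z// RintegralT_cst Rintegral_gauss_sqr.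
by move=> [] /=; rewrite -/m; lra.
Qed.

End gaussian_all_moments.

(** * Distribution functions of centred normal laws *)

Section gaussian_kolmogorov.
Context {R : realType}.
Local Notation mu := (@lebesgue_measure R).
Local Notation gauss :=
  (@normal_prob R 0 1 : probability (measurableTypeR R) R).
Local Notation phi := (@normal_pdf R 0 1).

(** Equivalent to [4 <= 2 pi <= 9], for which [2 <= pi < 4] is enough. *)
Lemma normal_peak1_bounds : 3^-1 <= normal_peak (1 : R) <= 2^-1.
Proof.
have p0 : 0 < pi *+ 2 :> R by rewrite -mulr_natr mulr_gt0// pi_gt0.
have p2 := @pi_ge2 R; have p4 : pi < 4 :> R by have := @pihalf_lt2 R; lra.
have s0 : 0 < Num.sqrt (pi *+ 2) :> R by rewrite sqrtr_gt0.
rewrite /normal_peak expr1n mul1r !lef_pV2 ?posrE//; apply/andP; split.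
- rewrite -[leRHS]ger0_norm// -sqrtr_sqr ler_sqrt ?sqr_ge0//.
  by rewrite -(mulr_natr pi); lra.
- rewrite -[leLHS]ger0_norm// -sqrtr_sqr ler_sqrt ?(ltW p0)//.
  by rewrite -(mulr_natr pi); lra.
Qed.

(** From [exp t >= 1 + t]. A rational majorant of the density keeps the later estimates within
    polynomial arithmetic. *)
Lemma normal_pdf01_le (m x : R) : 0 <= m -> m <= `|x| ->
  phi x <= 2^-1 / (1 + m ^+ 2 / 2).
Proof.
have /andP[_ k2] := normal_peak1_bounds.
move=> m0 mx; rewrite normal_pdf01E.
rewrite ler_pM ?normal_peak_ge0 ?expR_ge0 ?k2// expRN.
have m2 : m ^+ 2 <= x ^+ 2 by rewrite -(real_normK (num_real x)) lerXn2r.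
have := sqr_ge0 m => m20.
rewrite lef_pV2 ?posrE ?expR_gt0//; last by lra.
by apply: le_trans (expR_ge1Dx _); lra.
Qed.

Lemma normal_pdf01_ge (x : R) : `|x| <= 1 -> 6^-1 <= phi x.
Proof.
have /andP[k1 _] := normal_peak1_bounds.
move=> x1; rewrite normal_pdf01E.
have -> : 6^-1 = 3^-1 * 2^-1 :> R by field.
rewrite ler_pM ?k1//.
have x2 : x ^+ 2 <= 1 by rewrite -(real_normK (num_real x)) expr_le1.
by apply: le_trans (expR_ge1Dx _); lra.
Qed.

Definition gauss_cdf (z : R) : R := fine (gauss `]-oo, z]%classic).

Lemma gauss_cdfE z : (gauss_cdf z)%:E = gauss `]-oo, z]%classic.
Proof. by rewrite fineK// fin_num_measure. Qed.

Lemma gauss_cdfB (p q : R) : p <= q ->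
  (gauss_cdf q - gauss_cdf p)%:E = (\int[mu]_(x in `]p, q]) (phi x)%:E)%E.
Proof.
move=> pq; have -> : gauss_cdf q = gauss_cdf p + fine (gauss `]p, q]%classic).
  rewrite -fineD ?fin_num_measure// -measureU//.
  - congr (fine (gauss _)); apply/seteqP; split => x /=; rewrite !in_itv/=.
      by case: (leP x p) => [|px] ? ; [left|right].
    by case=> [xp|/andP[]//]; exact: le_trans pq.
  - apply/seteqP; split => x //=; rewrite !in_itv/= => -[xp /andP[px _]].
    by rewrite ltNge xp in px.
rewrite addrAC subrr add0r fineK ?fin_num_measure//.
Qed.

Lemma gauss_cdf_nd (p q : R) : p <= q -> gauss_cdf p <= gauss_cdf q.
Proof.
move=> pq; rewrite -subr_ge0 -lee_fin gauss_cdfB//.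
by apply: integral_ge0 => x _; rewrite lee_fin normal_pdf_ge0.
Qed.

Lemma gauss_cdf_bounds (z : R) : 0 <= gauss_cdf z <= 1.
Proof.
by rewrite -!lee_fin gauss_cdfE measure_ge0/= probability_le1.
Qed.

Lemma gauss_cdfB_le (p q m : R) : p <= q -> 0 <= m ->
  (forall x, p < x -> x <= q -> m <= `|x|) ->
  gauss_cdf q - gauss_cdf p <= (q - p) * (2^-1 / (1 + m ^+ 2 / 2)).
Proof.
move=> pq m0 hm; rewrite -lee_fin gauss_cdfB//.
have -> : ((q - p) * (2^-1 / (1 + m ^+ 2 / 2)))%:E
    = (\int[mu]_(x in `]p, q]) (2^-1 / (1 + m ^+ 2 / 2))%:E)%E.
  rewrite integral_cst//= lebesgue_measure_itv/= lte_fin.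
  case: ifPn => pq'; first by rewrite -EFinB -EFinM mulrC.
  by rewrite (le_anti (x := p) (y := q)) ?pq ?leNgt// subrr mul0r mule0.
apply: ge0_le_integral => //.
- by move=> x _; rewrite lee_fin normal_pdf_ge0.
- apply/measurable_EFinP; apply: measurable_funTS.
  exact: measurable_normal_pdf.
- move=> x; rewrite /= in_itv/= => /andP[px xq].
  by rewrite lee_fin; apply: normal_pdf01_le => //; exact: hm.
Qed.

Lemma gauss_cdfB_ge (p q : R) : p <= q -> -1 <= p -> q <= 1 ->
  (q - p) / 6 <= gauss_cdf q - gauss_cdf p.
Proof.
move=> pq p1 q1; rewrite -lee_fin gauss_cdfB//.
have -> : ((q - p) / 6)%:E = (\int[mu]_(x in `]p, q]) (6^-1)%:E)%E.
  rewrite integral_cst//= lebesgue_measure_itv/= lte_fin.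
  case: ifPn => pq'; first by rewrite -EFinB -EFinM mulrC.
  by rewrite (le_anti (x := p) (y := q)) ?pq ?leNgt// subrr mul0r mule0.
apply: ge0_le_integral => //.
- apply/measurable_EFinP; apply: measurable_funTS.
  exact: measurable_normal_pdf.
- move=> x; rewrite /= in_itv/= => /andP[px xq].
  rewrite lee_fin; apply: normal_pdf01_ge; rewrite ler_norml.
  by rewrite (le_trans xq q1) (le_trans p1 (ltW px)).
Qed.

(** A mean value estimate between [z] and [z / s]. If [m] is the modulus of the endpoint nearer to
    [0], the density is bounded by its majorant at [m], and the distance of the endpoints is
    [m (1 / s - 1)] for [s < 1] and [m (s - 1)] for [s >= 1]. What remains after bounding [m] times
    the majorant is absorbed by [|1 - s ^ 2|], except for small [s]. *)
Lemma gauss_cdf_scale (s z : R) : 0 < s ->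
  `|gauss_cdf (z / s) - gauss_cdf z| <= `|1 - s ^+ 2|.
Proof.
move=> s0.
(* The left side is [m / (2 + m ^ 2)], with maximum [sqrt 2 / 4]; [3 / 8] is a rational number
   slightly above it. *)
have key m : 0 <= m -> m * (2^-1 / (1 + m ^+ 2 / 2)) <= 3 / 8 :> R.
  move=> m0; have := sqr_ge0 m; have := sqr_ge0 (m - 3 / 2) => h1 h2.
  by rewrite mulrA ler_pdivrMr; nra.
case: (ltP s 1) => s1.
- have s2 : 0 <= 1 - s ^+ 2 by nra.
  rewrite (ger0_norm s2).
  (* For small [s] the factor [1 / s] ruins the mean value estimate. But [z] and [z / s] lie on the
     same side of [0], and the value at [0] is between [1 / 6] and [5 / 6], so the difference is at
     most [5 / 6 < 21 / 25 <= 1 - s ^ 2]. *)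
  case: (ltP s (2 / 5)) => s4.
    have h1 : (0 - -1) / 6 <= gauss_cdf 0 - gauss_cdf (-1).
      by apply: gauss_cdfB_ge; lra.
    have h2 : (1 - 0) / 6 <= gauss_cdf 1 - gauss_cdf 0.
      by apply: gauss_cdfB_ge; lra.
    have /andP[_ h3] := gauss_cdf_bounds 1.
    have /andP[h4 _] := gauss_cdf_bounds (-1).
    have ss : s ^+ 2 <= 4 / 25 by nra.
    have /andP[? ?] := gauss_cdf_bounds z.
    have /andP[? ?] := gauss_cdf_bounds (z / s).
    case: (leP 0 z) => z0.
      have zs0 : 0 <= z / s by rewrite divr_ge0// ltW.
      have := gauss_cdf_nd z0; have := gauss_cdf_nd zs0.
      by rewrite ler_norml => ? ?; apply/andP; split; lra.
    have zs0 : z / s <= 0 by rewrite mulr_le0_ge0 ?invr_ge0 ?ltW.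
    have := gauss_cdf_nd (ltW z0); have := gauss_cdf_nd zs0.
    by rewrite ler_norml => ? ?; apply/andP; split; lra.
  have sV : 1 <= s^-1 by rewrite invf_ge1// ltW.
  have bnd : `|z| * (s^-1 - 1) * (2^-1 / (1 + `|z| ^+ 2 / 2)) <= 1 - s ^+ 2.
    have := key _ (normr_ge0 z); set u := _ / (1 + _) => hu.
    have -> : `|z| * (s^-1 - 1) * u = `|z| * u * (1 - s) / s.
      by field; rewrite gt_eqF.
    by rewrite ler_pdivrMr//; nra.
  case: (leP 0 z) => z0.
    have zz : z <= z / s by rewrite ler_peMr.
    have := @gauss_cdfB_le z (z / s) `|z| zz (normr_ge0 z).
    have := gauss_cdf_nd zz; rewrite -subr_ge0 => d0; rewrite (ger0_norm d0).
    move=> H; apply: le_trans (H _) _.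
      by move=> x zx _; rewrite (ger0_norm z0) (le_trans (ltW zx))// ler_norm.
    by move: bnd; rewrite (ger0_norm z0) mulrBr mulr1.
  have zz : z / s <= z by rewrite ler_neMr// ltW.
  have := @gauss_cdfB_le (z / s) z `|z| zz (normr_ge0 z).
  have := gauss_cdf_nd zz; rewrite -subr_ge0 => d0.
  rewrite distrC (ger0_norm d0).
  move=> H; apply: le_trans (H _) _.
    move=> x _ xz; rewrite (ltr0_norm z0) ltr0_norm ?lerN2//.
    exact: le_lt_trans z0.
  move: bnd; rewrite (ltr0_norm z0) => /(le_trans _); apply.
  by rewrite mulrBr mulr1 mulNr opprK addrC.
- have s2 : 1 - s ^+ 2 <= 0 by nra.
  rewrite (ler0_norm s2).
  have sV : s^-1 <= 1 by rewrite invf_le1.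
  have bnd : `|z / s| * (s - 1) * (2^-1 / (1 + `|z / s| ^+ 2 / 2))
      <= - (1 - s ^+ 2).
    have := key _ (normr_ge0 (z / s)); set u := _ / (1 + _) => hu.
    by rewrite mulrAC; nra.
  have zE : z = z / s * s by rewrite divfK// gt_eqF.
  case: (leP 0 z) => z0.
    have zs0 : 0 <= z / s by rewrite divr_ge0// ltW.
    have zz : z / s <= z by rewrite ler_piMr.
    have := @gauss_cdfB_le (z / s) z `|z / s| zz (normr_ge0 _).
    have := gauss_cdf_nd zz; rewrite -subr_ge0 => d0.
    rewrite distrC (ger0_norm d0).
    move=> H; apply: le_trans (H _) _.
      by move=> x zx _; rewrite (ger0_norm zs0) (le_trans (ltW zx))// ler_norm.
    move: bnd; rewrite (ger0_norm zs0) => /(le_trans _); apply.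
    by rewrite mulrBr mulr1 -zE.
  have zs0 : z / s <= 0 by rewrite mulr_le0_ge0 ?invr_ge0 ?ltW.
  have zz : z <= z / s by rewrite ler_niMr// ltW.
  have := @gauss_cdfB_le z (z / s) `|z / s| zz (normr_ge0 _).
  have := gauss_cdf_nd zz; rewrite -subr_ge0 => d0; rewrite (ger0_norm d0).
  move=> H; apply: le_trans (H _) _.
    move=> x _ xz; rewrite (ler0_norm zs0) ler0_norm ?lerN2//.
    exact: le_trans zs0.
  move: bnd; rewrite (ler0_norm zs0) => /(le_trans _); apply.
  by rewrite mulrBr mulr1 mulNr -zE opprK addrC.
Qed.

(** At [s = 0] the set is empty or everything and the bound is [1]. This case does occur: the random
    variance vanishes for samples of size one. *)
Lemma gauss_halfline_scale (s z : R) : 0 <= s ->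
  `|fine (gauss [set x | s * x <= z]) - gauss_cdf z| <= `|1 - s ^+ 2|.
Proof.
rewrite le_eqVlt => /predU1P[<-|s0]; last first.
  rewrite (_ : [set x | s * x <= z] = `]-oo, z / s]%classic).
    exact: gauss_cdf_scale.
  by apply/seteqP; split => x /=; rewrite in_itv/= ler_pdivlMr// mulrC.
rewrite expr0n subr0 normr1 ler_norml.
have /andP[? ?] := gauss_cdf_bounds z.
set A := [set x | _]; have mA : measurable A.
  rewrite /A; under eq_set do rewrite mul0r.
  by case: (0 <= z); rewrite ?set_true ?set_false.
have /andP[] : 0 <= fine (gauss A) <= 1.
  by rewrite -!lee_fin fineK ?fin_num_measure// measure_ge0/= probability_le1.
by move: (fine (gauss A)) => {A mA} t ? ?; apply/andP; split; lra.
Qed.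

End gaussian_kolmogorov.

(** * Independent standard normal families *)

Section independence.
Context (d : measure_display) (T : measurableType d) (R : realType)
  (P : probability T R) (I : choiceType) (V : I -> {RV P >-> R}).
Hypothesis indepV : mutually_independent V.

(** Finite-dimensional events that do not involve [V j]: the pi-system on which the product rule can
    be read off directly. *)
Definition cylinders_but (j : I) : set (set T) :=
  [set B | exists (J : {fset I}) (A : I -> set R),
    [/\ forall i, measurable (A i), j \notin J
      & B = \bigcap_(i in [set` J]) (V i @^-1` A i)]].

(* [T] with the sigma-algebra generated by the [V i] with [i != j]. *)
Definition but_type (j : I) := g_sigma_algebraType (cylinders_but j).

Lemma measurable_preimage_RV i (A : set R) :
  measurable A -> measurable (V i @^-1` A).
Proof. by move=> mA; rewrite -[_ @^-1` _]setTI; exact: measurable_funPT. Qed.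

Lemma cylinders_but_measurable j : cylinders_but j `<=` measurable.
Proof.
move=> _ [J [A [mA _ ->]]]; apply: fin_bigcap_measurable => // i _.
exact: measurable_preimage_RV.
Qed.

Lemma cylinders_butT j : cylinders_but j setT.
Proof.
exists fset0%fset, (fun=> setT); split => //.
by apply/seteqP; split => // x _ i.
Qed.

Lemma cylinders_butI j : setI_closed (cylinders_but j).
Proof.
move=> _ _ [J1 [A1 [mA1 j1 ->]]] [J2 [A2 [mA2 j2 ->]]].
exists (J1 `|` J2)%fset, (fun i => (if i \in J1 then A1 i else setT) `&`
  (if i \in J2 then A2 i else setT))%classic; split.
- by move=> i; apply: measurableI; case: ifP.
- by rewrite inE negb_or j1.
apply/seteqP; split => w /=.
  move=> [h1 h2] i /=; rewrite inE => _; split.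
    by case: ifPn => // iJ; exact: h1.
  by case: ifPn => // iJ; exact: h2.
move=> h; split=> i /= iJ.
  by have /= := h i; rewrite inE iJ => /(_ isT)[].
by have /= := h i; rewrite inE iJ orbT => /(_ isT)[].
Qed.

(** The product rule is used twice: for [J], and for [J] with [j] added and [C] as the set at
    [j]. *)
Lemma cylinders_but_indep j B (C : set R) : cylinders_but j B -> measurable C ->
  P (B `&` V j @^-1` C)%classic = (P B * P (V j @^-1` C))%E.
Proof.
move=> [J [A [mA jJ ->]]] mC.
have := indepV J mA => ->.
pose A' i := if i == j then C else A i.
have mA' i : measurable (A' i) by rewrite /A'; case: ifP.
have AA' i : i \in J -> A' i = A i.
  by move=> iJ; rewrite /A' ifN//; apply: contraNneq jJ => <-.
have := indepV (j |` J)%fset mA'.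
rewrite big_fsetU1//= [in X in (X * _)%E]/A' eqxx.
rewrite (eq_big_seq (fun i => P (V i @^-1` A i))); last first.
  by move=> i iJ /=; rewrite AA'.
rewrite muleC => <-; congr (P _); apply/seteqP; split => w /=.
  move=> [h hj] i /=; rewrite !inE => /orP[/eqP->|iJ].
    by rewrite /A' eqxx.
  by rewrite AA'//; exact: h.
move=> h; split.
  by move=> i /= iJ; rewrite -(AA' i iJ); apply: h; rewrite /= !inE iJ orbT.
by have /= := h j; rewrite !inE eqxx /A' eqxx => /(_ isT).
Qed.

Lemma but_measurable j (B : set T) :
  measurable (B : set (but_type j)) -> measurable B.
Proof.
apply: smallest_sub; first exact: sigma_algebra_measurable.
exact: cylinders_but_measurable.
Qed.

(** As functions of [B], both sides are finite measures, and they agree on the pi-system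
    [cylinders_but j]. *)
Lemma but_indep j (B : set T) (C : set R) :
  measurable (B : set (but_type j)) -> measurable C ->
  P (B `&` V j @^-1` C)%classic = (P B * P (V j @^-1` C))%E.
Proof.
move=> mB mC; have mVC := measurable_preimage_RV j mC.
have p0 : 0 <= fine (P (V j @^-1` C)) by rewrite fine_ge0.
pose m1 : {measure set T -> \bar R} := mrestr P mVC.
pose m2 : {measure set T -> \bar R} := mscale (NngNum p0) P.
have : m1 B = m2 B.
  apply: (@g_sigma_algebra_measure_unique _ _ _ (cylinders_but j)
    (@cylinders_but_measurable j) (fun=> setT)) => //.
  - by move=> _; exact: cylinders_butT.
  - by rewrite bigcup_const.
  - exact: cylinders_butI.
  - move=> A hA; rewrite /m1 /m2/= /mrestr /mscale/=.
    rewrite cylinders_but_indep// fineK ?fin_num_measure//.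
    by rewrite muleC.
  - move=> _; rewrite /m1/= /mrestr setTI.
    by rewrite (le_lt_trans (probability_le1 _ _)) ?ltry.
rewrite /m1 /m2/= /mrestr /mscale/= => ->.
by rewrite fineK ?fin_num_measure// muleC.
Qed.

Lemma measurable_fun_but j (d' : measure_display) (T' : measurableType d')
    (f : T -> T') :
  measurable_fun [set: but_type j] f -> measurable_fun [set: T] f.
Proof.
move=> mf _ A mA; rewrite setTI; apply: (@but_measurable j).
by rewrite -[X in measurable X]setTI; exact: mf.
Qed.

Lemma measurable_RV_but i j : i != j ->
  measurable_fun [set: but_type j] (V i : but_type j -> R).
Proof.
move=> ij _ A mA; rewrite setTI; apply: sub_sigma_algebra.
exists [fset i]%fset, (fun=> A); split => //; first by rewrite inE eq_sym.
apply/seteqP; split => w /=.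
  by move=> h k /=; rewrite inE => /eqP ->.
by move=> /(_ i); rewrite /= inE eqxx => /(_ isT).
Qed.

End independence.

(** * Replacing one variable by an independent Gaussian copy *)

Section resampling.
Context (d : measure_display) (T : measurableType d) (R : realType)
  (P : probability T R) (I : choiceType) (V : I -> {RV P >-> R}).
Hypothesis indepV : mutually_independent V.
Hypothesis normalV : forall i (A : set R), measurable A ->
  distribution P (V i) A = normal_prob 0 1 A.
Local Notation gauss :=
  (@normal_prob R 0 1 : probability (measurableTypeR R) R).

Section law_of_pair.
Variable j : I.
Local Notation Tj := (but_type V j).

(** The identity into the coarser sigma-algebra packs all variables other than [V j] into a single
    random element. Its joint law with [V j] is then a product measure, and Fubini applies. *)
Let W : T -> Tj := fun w => w.

Let measurableW : measurable_fun [set: T] W.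
Proof.
by move=> _ A mA; rewrite setTI; exact: (@but_measurable _ _ _ _ _ V j).
Qed.

Let WV : T -> Tj * measurableTypeR R := fun w => (W w, V j w).

Let measurableWV : measurable_fun [set: T] WV.
Proof. exact: (measurable_fun_pair measurableW (measurable_funPT (V j))). Qed.

Let mW : {mfun T >-> Tj} :=
  HB.pack W (isMeasurableFun.Build _ _ _ _ W measurableW).
Let mWV : {mfun T >-> (Tj * measurableTypeR R)%type} :=
  HB.pack WV (isMeasurableFun.Build _ _ _ _ WV measurableWV).

Let law : forall X, measurable X ->
  (distribution P mW \x gauss)%E X = distribution P mWV X.
Proof.
apply: product_measure_unique => A B mA mB /=.
transitivity (P (A `&` V j @^-1` B)); first by [].
rewrite (but_indep indepV)//; congr (_ * _)%E.
exact: (normalV j mB).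
Qed.

(** Conditioning on all variables except [V j], with the conditional expectation written as an
    explicit Gaussian integral. *)
Lemma ge0_integral_resample (psi : Tj * measurableTypeR R -> \bar R) :
  measurable_fun [set: Tj * measurableTypeR R] psi ->
  (forall z, (0 <= psi z)%E) ->
  (\int[P]_w psi (w : Tj, V j w) = \int[P]_w \int[gauss]_y psi (w : Tj, y))%E.
Proof.
move=> mpsi psi0.
transitivity (\int[distribution P mWV]_z psi z)%E.
  by rewrite ge0_integral_distribution.
transitivity (\int[distribution P mW \x gauss]_z psi z)%E.
  by apply: eq_measure_integral => A mA _; exact/esym/law.
rewrite fubini_tonelli1// ge0_integral_distribution//.
  exact: measurable_fun_fubini_tonelli_F.
by move=> z; apply: integral_ge0 => y _; exact: psi0.
Qed.

Lemma integral_resample (psi : Tj * measurableTypeR R -> \bar R) :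
  measurable_fun [set: Tj * measurableTypeR R] psi ->
  P.-integrable [set: T] (fun w => psi (w : Tj, V j w)) ->
  (\int[P]_w psi (w : Tj, V j w) = \int[P]_w \int[gauss]_y psi (w : Tj, y))%E.
Proof.
move=> mpsi Ipsi.
have Iprod : (distribution P mW \x gauss)%E.-integrable setT psi.
  apply/integrableP; split => //.
  have /integrableP[_] := Ipsi; congr (_ < _)%E.
  rewrite (ge0_integral_resample (psi := fun z => `|psi z|%E))//; last first.
    exact: measurableT_comp.
  rewrite fubini_tonelli1//; last exact: measurableT_comp.
  rewrite ge0_integral_distribution//.
    by apply: measurable_fun_fubini_tonelli_F => //; exact: measurableT_comp.
  by move=> z; apply: integral_ge0 => y _.
transitivity (\int[distribution P mWV]_z psi z)%E.
  by rewrite integral_distribution.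
transitivity (\int[distribution P mW \x gauss]_z psi z)%E.
  by apply: eq_measure_integral => A mA _; exact/esym/law.
have IF := integrable_fubini_F Iprod.
have mF := measurable_int _ IF.
rewrite -integral12_prod_meas1//; apply: integral_distribution; first exact: mF.
move/integrableP : IF => [_].
rewrite ge0_integral_distribution//; last exact: measurableT_comp.
move=> FF; apply/integrableP; split => //.
exact: (measurableT_comp mF measurableW).
Qed.

End law_of_pair.
End resampling.

(** * Linear combinations with random, independent coefficients *)

Section normal_family.
Context (d : measure_display) (T : measurableType d) (R : realType)
  (P : probability T R) (I : choiceType) (V : I -> {RV P >-> R}).
Hypothesis indepV : mutually_independent V.
Hypothesis normalV : forall i (A : set R), measurable A ->
  distribution P (V i) A = normal_prob 0 1 A.
Local Notation gauss :=
  (@normal_prob R 0 1 : probability (measurableTypeR R) R).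

Lemma all_moments_RV j : all_moments P (V j).
Proof.
split=> // p; have [_ /(_ p) /integrableP[mX IX]] := @all_moments_gauss R.
apply/integrableP; split.
  by apply/measurable_EFinP; exact: measurable_funX.
pose psi (z : but_type V j * measurableTypeR R) := `|(z.2 ^+ p)%:E|%E.
have mpsi : measurable_fun [set: but_type V j * measurableTypeR R] psi.
  apply: measurableT_comp => //; apply/measurable_EFinP.
  by apply: measurable_funX; exact: measurable_snd.
have := ge0_integral_resample indepV normalV mpsi (fun=> abse_ge0 _).
rewrite /psi/= => ->; rewrite integral_cst//= probability_setT mule1.
exact: IX.
Qed.

Lemma Rintegral_resample j (B : T -> R) m :
  measurable_fun [set: but_type V j] (B : but_type V j -> R) ->
  all_moments P B ->
  \int[P]_w (B w * V j w ^+ m) = \int[P]_w B w * \int[gauss]_y y ^+ m.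
Proof.
move=> mB hB.
have hX : all_moments gauss (fun y => y ^+ m).
  exact/all_momentsX/all_moments_gauss.
have hBV : all_moments P (fun w => B w * V j w ^+ m).
  by apply: all_momentsM => //; apply: all_momentsX; exact: all_moments_RV.
pose psi (z : but_type V j * measurableTypeR R) := (B z.1 * z.2 ^+ m)%:E.
have mpsi : measurable_fun [set: but_type V j * measurableTypeR R] psi.
  apply/measurable_EFinP; apply: measurable_funM.
    exact: (measurableT_comp mB).
  by apply: measurable_funX; exact: measurable_snd.
have := integral_resample indepV normalV mpsi (all_moments_integrable hBV).
rewrite /psi/= => h; rewrite {1}/Rintegral h.
under eq_integral => w _.
  rewrite integral_EFin_Rintegral; last first.
    apply: all_moments_integrable; apply: all_momentsM => //.
    exact: all_moments_cst.
  rewrite RintegralT_Z// mulrC.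
  over.
rewrite integral_EFin_Rintegral/=; last first.
  apply: all_moments_integrable; apply: all_momentsM => //.
  exact: all_moments_cst.
by rewrite RintegralT_Z// mulrC.
Qed.

(* The [V (u i)] with [i < k] are replaced one at a time by the Gaussian
   variable [x] of the inner integral, using Gaussian stability. *)
Lemma ge0_integral_gauss_mixture (u : nat -> I) (b : nat -> T -> R) (n : nat)
    (f : R -> \bar R) :
  injective u ->
  (forall i k, measurable_fun [set: but_type V (u k)]
                 (b i : but_type V (u k) -> R)) ->
  measurable_fun [set: R] f -> (forall x, (0 <= f x)%E) ->
  (\int[P]_w f (\sum_(i < n) b i w * V (u i) w)%R =
   \int[P]_w \int[gauss]_x f (Num.sqrt (\sum_(i < n) b i w ^+ 2) * x)%R)%E.
Proof.
move=> inju mb mf f0.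
pose tail k w := \sum_(k <= i < n) b i w * V (u i) w.
pose r k w := Num.sqrt (\sum_(i < k) b i w ^+ 2).
suff claim k : (k <= n)%N ->
    (\int[P]_w f (\sum_(i < n) b i w * V (u i) w)%R =
     \int[P]_w \int[gauss]_x f (r k w * x + tail k w)%R)%E.
  rewrite (claim n (leqnn n)).
  apply: eq_integral => w _; apply: eq_integral => x _.
  by rewrite /tail big_geq// addr0.
elim: k => [_|k IHk kn].
  apply: eq_integral => w _; under eq_integral do
    rewrite /r big_ord0 sqrtr0 mul0r add0r /tail big_mkord.
  by rewrite integral_gauss_cst.
rewrite IHk; last exact: ltnW.
pose psi (z : but_type V (u k) * measurableTypeR R) : \bar R :=
  (\int[gauss]_x f (r k z.1 * x + (b k z.1 * z.2 + tail k.+1 z.1))%R)%E.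
have mr : measurable_fun [set: but_type V (u k)] (r k : but_type V (u k) -> R).
  apply: measurableT_comp.
    by apply: continuous_measurable_fun; exact: sqrt_continuous.
  by apply: measurable_sum => i; apply: measurable_funX; exact: mb.
have mtail : measurable_fun [set: but_type V (u k)]
    (tail k.+1 : but_type V (u k) -> R).
  rewrite /tail; under eq_fun do rewrite big_nat_cond.
  under eq_fun do rewrite big_mkcond/=.
  apply: measurable_sum => i.
  case: (boolP ((k < i < n)%N && true)) => [/andP[/andP[ki _] _]|_].
    apply: measurable_funM; first exact: mb.
    apply: measurable_RV_but; apply: contraTneq ki => /inju ->.
    by rewrite ltnn.
  exact: measurable_cst.
pose phi (z : (but_type V (u k) * measurableTypeR R) * measurableTypeR R) :=
  f (r k z.1.1 * z.2 + (b k z.1.1 * z.1.2 + tail k.+1 z.1.1))%R.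
have mphi : measurable_fun setT phi.
  apply: (measurableT_comp mf).
  have m11 : measurable_fun setT (fun z : (but_type V (u k) * measurableTypeR R)
      * measurableTypeR R => z.1.1).
    exact: (measurableT_comp measurable_fst measurable_fst).
  apply: measurable_funD.
    apply: measurable_funM; first exact: (measurableT_comp mr m11).
    exact: measurable_snd.
  apply: measurable_funD; last exact: (measurableT_comp mtail m11).
  apply: measurable_funM; first exact: (measurableT_comp (mb _ _) m11).
  exact: (measurableT_comp measurable_snd measurable_fst).
have mpsi : measurable_fun setT psi.
  apply: (@measurable_fun_fubini_tonelli_F _ _ _ _ _ gauss phi) => //.
  by move=> z; exact: f0.
have psi0 z : (0 <= psi z)%E by apply: integral_ge0 => x _; exact: f0.
transitivity (\int[P]_w psi (w, V (u k) w))%E.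
  apply: eq_integral => w _; apply: eq_integral => x _; rewrite /=.
  by congr (f (_ + _)); rewrite /tail big_ltn.
rewrite (ge0_integral_resample indepV normalV mpsi psi0).
apply: eq_integral => w _; rewrite /psi/=.
pose g t := f (t + tail k.+1 w)%R.
have mg : measurable_fun [set: R] g.
  by apply: (measurableT_comp mf); apply: measurable_funD.
have g0 t : (0 <= g t)%E by exact: f0.
transitivity (\int[gauss]_y \int[gauss]_x g (b k w * y + r k w * x)%R)%E.
  apply: eq_integral => y _; apply: eq_integral => x _.
  by rewrite /g; congr f; rewrite addrA; congr (_ + _); rewrite addrC.
rewrite (ge0_integral_gauss_stable _ _ mg g0).
apply: eq_integral => x _; rewrite /g /r; congr (f (Num.sqrt _ * _ + _)).
rewrite big_ord_recr/= addrC sqr_sqrtr//.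
by apply: sumr_ge0 => i _; exact: sqr_ge0.
Qed.

End normal_family.

(** * Mean and second moment of Gaussian quadratic forms *)

Section quadratic_forms.
Context (d : measure_display) (T : measurableType d) (R : realType)
  (P : probability T R) (I : choiceType) (V : I -> {RV P >-> R}).
Hypothesis indepV : mutually_independent V.
Hypothesis normalV : forall i (A : set R), measurable A ->
  distribution P (V i) A = normal_prob 0 1 A.
Local Notation gauss :=
  (@normal_prob R 0 1 : probability (measurableTypeR R) R).
Variable u : nat -> I.
Hypothesis inju : injective u.

Definition linear_form (a : nat -> R) (k : nat) (w : T) : R :=
  \sum_(i < k) a i * V (u i) w.

Definition quadratic_form (Q : nat -> nat -> R) (k : nat) (w : T) : R :=
  \sum_(i < k) \sum_(j < k) Q i j * V (u i) w * V (u j) w.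

Lemma linear_form_recr a k w :
  linear_form a k.+1 w = linear_form a k w + a k * V (u k) w.
Proof. by rewrite /linear_form big_ord_recr. Qed.

(** Isolates the last variable: the form is a polynomial of degree two in [V (u k)] whose
    coefficients do not involve it, so that [Rintegral_resample] applies to every term. *)
Lemma quadratic_form_recr Q k w : (forall i j, Q i j = Q j i) ->
  quadratic_form Q k.+1 w =
  quadratic_form Q k w + 2 * linear_form (Q k) k w * V (u k) w
  + Q k k * V (u k) w ^+ 2.
Proof.
move=> symQ; rewrite /quadratic_form big_ord_recr/=.
under eq_bigr do rewrite big_ord_recr/=.
rewrite big_split/= [X in _ + X]big_ord_recr/= !addrA expr2 mulrA.
congr (_ + _); rewrite -addrA; congr (_ + _).
rewrite -big_split/= /linear_form mulr_sumr mulr_suml.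
by apply: eq_bigr => i _; rewrite (symQ i k); ring.
Qed.

Lemma measurable_linear_form_but a k :
  measurable_fun [set: but_type V (u k)]
    (linear_form a k : but_type V (u k) -> R).
Proof.
apply: measurable_sum => i; apply: measurable_funM; first exact: measurable_cst.
by apply: measurable_RV_but; apply/eqP => /inju /eqP; rewrite ltn_eqF.
Qed.

Lemma measurable_quadratic_form_but Q k :
  measurable_fun [set: but_type V (u k)]
    (quadratic_form Q k : but_type V (u k) -> R).
Proof.
have mV (i : 'I_k) : measurable_fun [set: but_type V (u k)]
    (V (u i) : but_type V (u k) -> R).
  by apply: measurable_RV_but; apply/eqP => /inju /eqP; rewrite ltn_eqF.
apply: measurable_sum => i; apply: measurable_sum => j.
by apply: measurable_funM => //; apply: measurable_funM.
Qed.

Lemma all_moments_linear_form a k : all_moments P (linear_form a k).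
Proof.
apply: all_moments_sum => i _; apply: all_momentsM.
  exact: all_moments_cst.
exact: all_moments_RV.
Qed.

Lemma all_moments_quadratic_form Q k : all_moments P (quadratic_form Q k).
Proof.
apply: all_moments_sum => i _; apply: all_moments_sum => j _.
apply: all_momentsM; last exact: all_moments_RV.
by apply: all_momentsM; [exact: all_moments_cst|exact: all_moments_RV].
Qed.

Let hV k := all_moments_RV indepV normalV (u k).

Lemma Rintegral_RV_exp j m :
  \int[P]_w V j w ^+ m = \int[gauss]_y y ^+ m.
Proof.
have := @Rintegral_resample _ _ _ _ _ _ indepV normalV j (fun=> 1) m
  (measurable_cst _) (all_moments_cst P 1).
under eq_Rintegral do rewrite mul1r.
by rewrite RintegralT_cst mul1r.
Qed.

Lemma Rintegral_linear_form_sqr a k :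
  \int[P]_w linear_form a k w ^+ 2 = \sum_(i < k) a i ^+ 2.
Proof.
elim: k => [|k IHk].
  under eq_Rintegral do rewrite /linear_form big_ord0 expr0n.
  by rewrite RintegralT_cst big_ord0.
have hl := all_moments_linear_form a k.
have ml := @measurable_linear_form_but a k.
have hc (c : R) := all_moments_cst P c.
transitivity (\int[P]_w (linear_form a k w ^+ 2 +
    (2 * a k * (linear_form a k w * V (u k) w ^+ 1) +
     a k ^+ 2 * V (u k) w ^+ 2))).
  by apply: eq_Rintegral => w _; rewrite linear_form_recr; ring.
have h1 : all_moments P (fun w => linear_form a k w * V (u k) w ^+ 1).
  by apply: all_momentsM => //; exact: all_momentsX.
have h2 : all_moments P (fun w => V (u k) w ^+ 2) by exact: all_momentsX.
have h3 : all_moments P (fun w => a k ^+ 2 * V (u k) w ^+ 2).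
  exact: all_momentsM.
have h4 : all_moments P
    (fun w => 2 * a k * (linear_form a k w * V (u k) w ^+ 1)).
  exact: all_momentsM.
rewrite RintegralT_D; [|exact: all_momentsX|exact: all_momentsD].
rewrite RintegralT_D// !RintegralT_Z//.
rewrite (Rintegral_resample indepV normalV)// Rintegral_RV_exp.
rewrite Rintegral_gauss_id Rintegral_gauss_sqr IHk.
by rewrite big_ord_recr/=; ring.
Qed.

Variable Q : nat -> nat -> R.
Hypothesis symQ : forall i j, Q i j = Q j i.

Lemma Rintegral_quadratic_form k :
  \int[P]_w quadratic_form Q k w = \sum_(i < k) Q i i.
Proof.
elim: k => [|k IHk].
  under eq_Rintegral do rewrite /quadratic_form big_ord0.
  by rewrite RintegralT_cst big_ord0.
have hl := all_moments_linear_form (Q k) k.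
have hq := all_moments_quadratic_form Q k.
have ml := @measurable_linear_form_but (Q k) k.
have hc (c : R) := all_moments_cst P c.
transitivity (\int[P]_w (quadratic_form Q k w +
    (2 * (linear_form (Q k) k w * V (u k) w ^+ 1) +
     Q k k * V (u k) w ^+ 2))).
  by apply: eq_Rintegral => w _; rewrite quadratic_form_recr//; ring.
have h1 : all_moments P (fun w => linear_form (Q k) k w * V (u k) w ^+ 1).
  by apply: all_momentsM => //; exact: all_momentsX.
have h2 : all_moments P (fun w => V (u k) w ^+ 2) by exact: all_momentsX.
rewrite RintegralT_D//; last by apply: all_momentsD; exact: all_momentsM.
rewrite RintegralT_D; [|exact: all_momentsM|exact: all_momentsM].
rewrite !RintegralT_Z// (Rintegral_resample indepV normalV)//.
rewrite Rintegral_RV_exp Rintegral_gauss_id Rintegral_gauss_sqr IHk.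
by rewrite big_ord_recr/=; ring.
Qed.

(** So the variance is [2 |Q|_F ^ 2]. In the square of [q + 2 l v + Q k k v ^ 2] the odd powers of
    the last variable [v] integrate to zero. The fourth moment [3] contributes [3 (Q k k) ^ 2]: one
    part completes the squared trace, two parts go to the Frobenius norm. *)
Lemma Rintegral_quadratic_form_sqr k :
  \int[P]_w quadratic_form Q k w ^+ 2 =
  (\sum_(i < k) Q i i) ^+ 2 + 2 * \sum_(i < k) \sum_(j < k) Q i j ^+ 2.
Proof.
elim: k => [|k IHk].
  under eq_Rintegral do rewrite /quadratic_form big_ord0 expr0n.
  by rewrite RintegralT_cst !big_ord0 expr0n mulr0 addr0.
have hl := all_moments_linear_form (Q k) k.
have hq := all_moments_quadratic_form Q k.
have ml := @measurable_linear_form_but (Q k) k.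
have mq := @measurable_quadratic_form_but Q k.
have hc (c : R) := all_moments_cst P c.
pose q := quadratic_form Q k; pose l := linear_form (Q k) k.
pose v := V (u k).
transitivity (\int[P]_w (q w ^+ 2 + (4 * (l w ^+ 2 * v w ^+ 2) +
    (Q k k ^+ 2 * v w ^+ 4 + (4 * (q w * l w * v w ^+ 1) +
    (2 * Q k k * (q w * v w ^+ 2) + 4 * Q k k * (l w * v w ^+ 3))))))).
  apply: eq_Rintegral => w _; rewrite quadratic_form_recr// /q /l /v.
  by ring.
have hX p := all_momentsX p (hV k).
have h1 : all_moments P (fun w => l w ^+ 2 * v w ^+ 2).
  by apply: all_momentsM => //; exact: all_momentsX.
have h2 : all_moments P (fun w => v w ^+ 4) by exact: hX.
have h3 : all_moments P (fun w => q w * l w * v w ^+ 1).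
  by apply: all_momentsM => //; exact: all_momentsM.
have h4 : all_moments P (fun w => q w * v w ^+ 2) by exact: all_momentsM.
have h5 : all_moments P (fun w => l w * v w ^+ 3) by exact: all_momentsM.
have hZ c f : all_moments P f -> all_moments P (fun w => c * f w).
  exact: all_momentsM.
rewrite RintegralT_D; [|exact: all_momentsX|]; last first.
  do 4 (apply: all_momentsD; first exact: hZ); exact: hZ.
rewrite RintegralT_D; [|exact: hZ|]; last first.
  do 3 (apply: all_momentsD; first exact: hZ); exact: hZ.
rewrite RintegralT_D; [|exact: hZ|]; last first.
  do 2 (apply: all_momentsD; first exact: hZ); exact: hZ.
rewrite RintegralT_D; [|exact: hZ|]; last first.
  by apply: all_momentsD; exact: hZ.
rewrite RintegralT_D; [|exact: hZ|exact: hZ].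
rewrite !RintegralT_Z//.
rewrite (@Rintegral_resample _ _ _ _ _ _ indepV normalV _ (fun w => l w ^+ 2))//;
  [|exact: measurable_funX|exact: all_momentsX].
rewrite Rintegral_RV_exp.
rewrite (@Rintegral_resample _ _ _ _ _ _ indepV normalV _ (fun w => q w * l w))//;
  [|exact: measurable_funM|exact: all_momentsM].
rewrite (@Rintegral_resample _ _ _ _ _ _ indepV normalV _ q)//.
rewrite (@Rintegral_resample _ _ _ _ _ _ indepV normalV _ l)//.
rewrite Rintegral_gauss_id Rintegral_gauss_sqr Rintegral_gauss_cube.
rewrite Rintegral_gauss_fourth.
rewrite Rintegral_linear_form_sqr IHk Rintegral_quadratic_form.
have -> : \sum_(i < k.+1) \sum_(j < k.+1) Q i j ^+ 2 =
    \sum_(i < k) \sum_(j < k) Q i j ^+ 2 +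
    2 * (\sum_(i < k) Q k i ^+ 2) + Q k k ^+ 2.
  rewrite big_ord_recr/=.
  under eq_bigr do rewrite big_ord_recr/=.
  rewrite big_split/= [X in _ + X]big_ord_recr/= !addrA; congr (_ + _).
  rewrite -addrA; congr (_ + _); rewrite -big_split/= mulr_sumr.
  by apply: eq_bigr => i _; rewrite (symQ i k); ring.
by rewrite big_ord_recr/=; ring.
Qed.

End quadratic_forms.

(** * Distance from a Gaussian variance mixture to the standard normal law *)

Section variance_mixture.
Context (R : realType) (d : measure_display) (T : measurableType d)
  (P : probability T R) (d' : measure_display) (T' : measurableType d')
  (P' : probability T' R) (X : {RV P >-> R}) (N : {RV P' >-> R}) (S : T -> R).
Local Notation gauss :=
  (@normal_prob R 0 1 : probability (measurableTypeR R) R).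
Hypothesis normalN : forall A : set R, measurable A ->
  distribution P' N A = normal_prob 0 1 A.
Hypothesis S_ge0 : forall w, 0 <= S w.
Hypothesis momentsS2 : all_moments P (fun w => S w ^+ 2).
Hypothesis measurableS : measurable_fun [set: T] S.
Hypothesis mixture : forall f : R -> \bar R,
  measurable_fun [set: R] f -> (forall x, (0 <= f x)%E) ->
  (\int[P]_w f (X w) = \int[P]_w \int[gauss]_x f (S w * x)%R)%E.

Lemma integrable_one_sub_sqr :
  P.-integrable [set: T] (EFin \o (fun w => `|1 - S w ^+ 2|)).
Proof.
apply: integrable_norm; apply: all_moments_integrable.
by apply: all_momentsD; [exact: all_moments_cst|exact: all_momentsN].
Qed.

(** For the indicator of a half-line, [mixture] expresses [cdf X z] as the mean of the conditional
    probabilities [a w]; the deterministic bound [gauss_halfline_scale] is then averaged over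
    [w]. *)
Lemma dKol_mixture : (dKol X N <= (\int[P]_w `|1 - S w ^+ 2|)%:E)%E.
Proof.
apply: ge_ereal_sup => _ [z _ <-].
have -> : cdf N z = (gauss_cdf z)%:E by rewrite gauss_cdfE; exact: normalN.
pose A : set (measurableTypeR R) := `]-oo, z]%classic.
have mA : measurable A by exact: measurable_itv.
pose B (w : T) : set (measurableTypeR R) := [set x | S w * x <= z].
have mS2 : measurable_fun [set: T * measurableTypeR R]
    (fun z : T * measurableTypeR R => S z.1 * z.2).
  by apply: measurable_funM => //; exact: (measurableT_comp measurableS).
have mB w : measurable (B w).
  have -> : B w = setT `&` (fun x : measurableTypeR R => S w * x) @^-1` A.
    by rewrite setTI; apply/seteqP; split => x; rewrite /A /B /= in_itv.
  exact: (measurable_fun_pair2 w mS2).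
have mI : measurable_fun [set: R] (fun x => (\1_A x)%:E : \bar R).
  by apply/measurable_EFinP; exact: measurable_indic.
have I0 x : (0 <= (\1_A x)%:E :> \bar R)%E by rewrite lee_fin.
have hI w : (\int[gauss]_x (\1_A (S w * x)%R)%:E = gauss (B w))%E.
  transitivity (\int[gauss]_x (\1_(B w) x)%:E)%E; last first.
    by rewrite integral_indic// setIT.
  by apply: eq_integral => x _; rewrite !indicE; congr ((nat_of_bool _)%:R%:E).
have mgB : measurable_fun [set: T] (fun w => gauss (B w)).
  under eq_fun do rewrite -hI.
  apply: (@measurable_fun_fubini_tonelli_F _ _ _ _ _ gauss
    (fun z => (\1_A (S z.1 * z.2))%:E)).
    exact: (measurableT_comp mI mS2).
  by move=> w; rewrite lee_fin.
pose a w := fine (gauss (B w)).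
have aE w : (a w)%:E = gauss (B w) by rewrite fineK// fin_num_measure.
have ma : measurable_fun [set: T] a.
  apply/measurable_EFinP; rewrite (_ : EFin \o a = fun w => gauss (B w))//.
  by apply/funext => w; rewrite /= aE.
have a01 w : 0 <= a w <= 1.
  by rewrite -!lee_fin aE measure_ge0/= probability_le1.
have Ia : P.-integrable [set: T] (EFin \o a).
  have I1 := finite_measure_integrable_cst P (1 : R) measurableT.
  apply: le_integrable I1 => //; first exact/measurable_EFinP.
  by move=> w _; rewrite /= lee_fin normr1 ger0_norm; case/andP: (a01 w).
have Ic : P.-integrable [set: T] (EFin \o (fun=> gauss_cdf z)).
  exact: finite_measure_integrable_cst.
have -> : cdf X z = (\int[P]_w a w)%:E.
  rewrite -integral_EFin_Rintegral//.
  transitivity (\int[P]_w (\1_A (X w))%:E)%E.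
    have mXA : measurable (X @^-1` A).
      by rewrite -[X in measurable X]setTI; exact: measurable_funPT.
    transitivity (P (X @^-1` A)); first by [].
    by rewrite -[in LHS](setIT (X @^-1` A)) -integral_indic.
  rewrite (mixture mI I0).
  by apply: eq_integral => w _; rewrite hI aE.
rewrite -EFinB/= lee_fin -[in X in _ - X](RintegralT_cst P (gauss_cdf z)).
rewrite -RintegralB//.
have IB : P.-integrable [set: T] (EFin \o (fun w => a w - gauss_cdf z)).
  exact: (integrableB measurableT Ia Ic).
apply: (le_trans (le_normr_Rintegral _ IB)) => //.
apply: le_Rintegral => //.
- exact: (integrable_norm IB).
- exact: integrable_one_sub_sqr.
- by move=> w _; exact: gauss_halfline_scale.
Qed.

Lemma ge0_integral_normalRV (f : R -> \bar R) :
  measurable_fun [set: R] f -> (forall x, (0 <= f x)%E) ->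
  (\int[P']_w f (N w) = \int[gauss]_x f x)%E.
Proof.
move=> mf f0.
pose N' : {mfun T' >-> measurableTypeR R} :=
  HB.pack (N : T' -> measurableTypeR R)
    (isMeasurableFun.Build _ _ _ _ (N : T' -> measurableTypeR R)
      (measurable_funPT N)).
transitivity (\int[distribution P' N']_x f x)%E.
  by rewrite ge0_integral_distribution.
by apply: eq_measure_integral => A mA _; exact: normalN.
Qed.

(** A coupling on [P \x gauss]: the maps [S w * x] and [x] have the laws of [X] and [N], and [f]
    changes by at most [|S w - 1| |x|] between them. The product structure separates the factor
    [E |x| = sqrt (2 / pi)], and [|S - 1| <= |S - 1| (1 + S) = |1 - S ^ 2|]. *)
Lemma dW_mixture :
  (dW X N <= (Num.sqrt (2 / pi) * \int[P]_w `|1 - S w ^+ 2|)%:E)%E.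
Proof.
apply: ge_ereal_sup => _ [f lipf <-].
have lf x y : `|f x - f y| <= `|x - y|.
  by have := lipf (x, y) (conj I I); rewrite /= mul1r.
have mf : measurable_fun [set: R] f.
  apply: continuous_measurable_fun => x; apply/cvgrPdist_le => e e0.
  near=> y; apply: le_trans (lf x y) _; near: y.
  by apply: cvgr_dist_le.
pose D := (P \x gauss)%E.
pose g (z : T * measurableTypeR R) : R := S z.1 * z.2.
have mg : measurable_fun [set: T * measurableTypeR R] g.
  by apply: measurable_funM => //; exact: (measurableT_comp measurableS).
have ms : measurable_fun [set: T * measurableTypeR R]
    (snd : T * measurableTypeR R -> R) by exact: measurable_snd.
have toX h : measurable_fun [set: R] h -> (forall x, (0 <= h x)%E) ->
    (\int[P]_w h (X w) = \int[D]_z h (g z))%E.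
  move=> mh h0; rewrite mixture// fubini_tonelli1//.
  exact: (measurableT_comp mh mg).
have toN h : measurable_fun [set: R] h -> (forall x, (0 <= h x)%E) ->
    (\int[P']_w h (N w) = \int[D]_z h z.2)%E.
  move=> mh h0; rewrite ge0_integral_normalRV//.
  rewrite (@fubini_tonelli1 _ _ _ _ _ P gauss (fun z => h z.2))//; last first.
    exact: (measurableT_comp mh ms).
  by rewrite /fubini_F/= integral_cst//= probability_setT mule1.
have mf' : measurable_fun [set: R] (EFin \o f) by exact/measurable_EFinP.
have mfp := measurable_funepos mf'.
have mfn := measurable_funeneg mf'.
(* The identity of laws is available for nonnegative functions only, so the positive and negative
   parts of [f] are transferred separately, before integrability is known. *)
have EX : ('E_P[f \o X] = \int[D]_z (f (g z))%:E)%E.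
  rewrite unlock integralE [RHS]integralE; congr (_ - _)%E.
    transitivity (\int[P]_w (EFin \o f)^\+ (X w))%E.
      by apply: eq_integral => w _; rewrite !funeposE.
    rewrite (toX _ mfp (funepos_ge0 _)).
    by apply: eq_integral => z _; rewrite !funeposE.
  transitivity (\int[P]_w (EFin \o f)^\- (X w))%E.
    by apply: eq_integral => w _; rewrite !funenegE.
  rewrite (toX _ mfn (funeneg_ge0 _)).
  by apply: eq_integral => z _; rewrite !funenegE.
have EN : ('E_P'[f \o N] = \int[D]_z (f z.2)%:E)%E.
  rewrite unlock integralE [RHS]integralE; congr (_ - _)%E.
    transitivity (\int[P']_w (EFin \o f)^\+ (N w))%E.
      by apply: eq_integral => w _; rewrite !funeposE.
    rewrite (toN _ mfp (funepos_ge0 _)).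
    by apply: eq_integral => z _; rewrite !funeposE.
  transitivity (\int[P']_w (EFin \o f)^\- (N w))%E.
    by apply: eq_integral => w _; rewrite !funenegE.
  rewrite (toN _ mfn (funeneg_ge0 _)).
  by apply: eq_integral => z _; rewrite !funenegE.
pose h1 (z : T * measurableTypeR R) : R := `|S z.1 - 1| * `|z.2|.
have mS1 : measurable_fun [set: T] (fun w => `|S w - 1|).
  by apply: measurableT_comp => //; apply: measurable_funB.
have mh1 : measurable_fun [set: T * measurableTypeR R] h1.
  apply: measurable_funM; first exact: (measurableT_comp mS1).
  exact: (measurableT_comp (@normr_measurable R setT)).
have S1_le w : `|S w - 1| <= `|1 - S w ^+ 2|.
  rewrite distrC -[X in _ <= `|X - _|](expr1n R 2) subr_sqr normrM.
  by rewrite ler_peMr// ger0_norm ?lerDl ?addr_ge0.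
have IS := integrable_one_sub_sqr.
have sq0 : 0 <= Num.sqrt (2 / pi) :> R by exact: sqrtr_ge0.
have h1_le : (\int[D]_z (h1 z)%:E
    <= (Num.sqrt (2 / pi) * \int[P]_w `|1 - S w ^+ 2|)%:E)%E.
  rewrite (@fubini_tonelli1 _ _ _ _ _ P gauss (fun z => (h1 z)%:E)); last 2 first.
  - exact/measurable_EFinP.
  - by move=> z; rewrite lee_fin mulr_ge0.
  rewrite -RintegralZl// -integral_EFin_Rintegral; last first.
    exact: (integrableZl measurableT _ IS).
  apply: ge0_le_integral => //.
  - by move=> w _; apply: integral_ge0 => x _; rewrite lee_fin mulr_ge0.
  - apply: (@measurable_fun_fubini_tonelli_F _ _ _ _ _ gauss
      (fun z => (h1 z)%:E)); first exact/measurable_EFinP.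
    by move=> z; rewrite lee_fin mulr_ge0.
  - exact: measurable_int (integrableZl measurableT _ IS).
  move=> w _; rewrite /fubini_F /h1/=.
  under eq_integral do rewrite EFinM.
  rewrite ge0_integralZl//; last first.
    by apply/measurable_EFinP; exact: normr_measurable.
  rewrite integral_gauss_norm -EFinM lee_fin mulrC.
  by rewrite ler_wpM2l.
have ID1 : D.-integrable setT (EFin \o h1).
  apply/integrableP; split; first exact/measurable_EFinP.
  under eq_integral do rewrite /= ger0_norm ?mulr_ge0//.
  by apply: le_lt_trans h1_le _; exact: ltry.
have IDx : D.-integrable setT (EFin \o (fun z : T * measurableTypeR R => `|z.2|)).
  apply/integrableP; split.
    by apply/measurable_EFinP; exact: (measurableT_comp (@normr_measurable R setT)).
  under eq_integral do rewrite /= normr_id.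
  rewrite -(toN (fun x => `|x|%:E)).
  - rewrite (ge0_integral_normalRV (f := fun x => `|x|%:E)).
    + by rewrite integral_gauss_norm ltry.
    + by apply/measurable_EFinP; exact: normr_measurable.
    + by move=> x; rewrite lee_fin.
  - by apply/measurable_EFinP; exact: normr_measurable.
  - by move=> x; rewrite lee_fin.
have IDc : D.-integrable setT (EFin \o cst `|f 0|).
  apply/integrableP; split; first exact/measurable_EFinP.
  rewrite -(toX (fun=> `|(`|f 0|)%:E|%E))//.
  by rewrite integral_cst//= probability_setT mule1 ltry.
have gB z : g z - z.2 = (S z.1 - 1) * z.2 by rewrite mulrBl mul1r.
have mf2 : measurable_fun [set: T * measurableTypeR R] (fun z => f z.2).
  exact: (measurableT_comp mf ms).
have mfg : measurable_fun [set: T * measurableTypeR R] (fun z => f (g z)).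
  exact: (measurableT_comp mf mg).
(* A Lipschitz function grows at most linearly: [|f x| <= |f 0| + |x|]. The coupling bound [h1] then
   transfers integrability to [f (g z)]. *)
have ID2 : D.-integrable setT (EFin \o (fun z => f z.2)).
  have Is := integrableD measurableT IDc IDx.
  apply: le_integrable Is => //; first exact/measurable_EFinP.
  move=> z _; rewrite /= lee_fin [leRHS]ger0_norm ?addr_ge0//.
  have := lf z.2 0; rewrite subr0 => h.
  by rewrite addrC -lerBlDr (le_trans _ h)// lerB_dist.
have ID3 : D.-integrable setT (EFin \o (fun z => f (g z))).
  have Is := integrableD measurableT (integrable_norm ID2) ID1.
  apply: le_integrable Is => //; first exact/measurable_EFinP.
  move=> z _; rewrite /= lee_fin [leRHS]ger0_norm ?addr_ge0 ?mulr_ge0//.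
  have := lf (g z) z.2; rewrite gB normrM => h.
  by rewrite addrC -lerBlDr (le_trans _ h)// lerB_dist.
have fD : forall h : T * measurableTypeR R -> R,
    D.-integrable setT (EFin \o h) ->
    (\int[D]_z (h z)%:E)%E = (\int[D]_z h z)%:E.
  by move=> h Ih; rewrite fineK//; exact: integrable_fin_num.
have IB : D.-integrable setT (EFin \o (fun z => f (g z) - f z.2)).
  exact: (integrableB measurableT ID3 ID2).
apply: le_trans h1_le.
rewrite EX EN fD// (fD (fun z => f z.2))// fD// -EFinB/= lee_fin -RintegralB//.
apply: (le_trans (le_normr_Rintegral _ IB)) => //.
apply: le_Rintegral => //.
- exact: (integrable_norm IB).
- move=> z _; apply: le_trans (lf _ _) _.
  by rewrite gB normrM.
Unshelve. all: by end_near. Qed.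

End variance_mixture.

(** * The matrix of the bilinear form *)

Section frobenius.
Context {R : realFieldType}.

Definition fro2 m n (B : 'M[R]_(m, n)) : R := \sum_i \sum_j B i j ^+ 2.

Lemma fro2_ge0 m n (B : 'M[R]_(m, n)) : 0 <= fro2 B.
Proof. by apply: sumr_ge0 => i _; apply: sumr_ge0 => j _; exact: sqr_ge0. Qed.

Lemma fro2_tr m n (B : 'M[R]_(m, n)) : fro2 B^T = fro2 B.
Proof.
rewrite /fro2 exchange_big/=.
by apply: eq_bigr => i _; apply: eq_bigr => j _; rewrite mxE.
Qed.

Lemma fro2_trace m n (B : 'M[R]_(m, n)) : fro2 B = \tr (B *m B^T).
Proof.
by apply: eq_bigr => i _; rewrite mxE; apply: eq_bigr => j _; rewrite mxE expr2.
Qed.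

Lemma fro2_col m n (B : 'M[R]_(m, n)) : fro2 B = \sum_j fro2 (col j B).
Proof.
rewrite /fro2 exchange_big/=; apply: eq_bigr => j _; apply: eq_bigr => i _.
by rewrite big_ord1 mxE.
Qed.

(** The hypothesis encodes [|B|_op ^ 2 <= K]; it is applied to each column of [C]. *)
Lemma fro2_mulmx_le m n p (B : 'M[R]_(m, n)) (K : R) (C : 'M[R]_(n, p)) :
  (forall v : 'cV_n, fro2 (B *m v) <= K * fro2 v) ->
  fro2 (B *m C) <= K * fro2 C.
Proof.
move=> hB; rewrite !fro2_col mulr_sumr; apply: ler_sum => j _.
by rewrite colE -mulmxA -colE.
Qed.

(** Cauchy-Schwarz on each row with weights [|B i j|] uses the row sums; exchanging the two sums
    then uses the column sums. *)
Lemma schur_test m n (B : 'M[R]_(m, n)) (r : R) : 0 <= r ->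
  (forall i, \sum_j `|B i j| <= r) -> (forall j, \sum_i `|B i j| <= r) ->
  forall v : 'cV_n, fro2 (B *m v) <= r ^+ 2 * fro2 v.
Proof.
move=> r0 hrow hcol v.
have row_le i : (B *m v) i 0 ^+ 2 <= r * \sum_j `|B i j| * v j 0 ^+ 2.
  rewrite mxE; set s := \sum_j `|B i j| * _.
  set t := \sum_j B i j * v j 0.
  have s0 : 0 <= s by apply: sumr_ge0 => j _; rewrite mulr_ge0 ?sqr_ge0.
  (* [2 c |b| |v| <= c ^ 2 |b| + |b| v ^ 2] *)
  have hc (c : R) : 2 * c * t <= c ^+ 2 * r + s.
    apply: (@le_trans _ _ (c ^+ 2 * (\sum_j `|B i j|) + s)); last first.
      by rewrite lerD2r ler_wpM2l ?sqr_ge0.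
    rewrite /t /s !mulr_sumr -big_split/=; apply: ler_sum => j _.
    have [b0|b0] := leP 0 (B i j).
      by rewrite ger0_norm//; have := sqr_ge0 (c - v j 0); nra.
    by rewrite ltr0_norm//; have := sqr_ge0 (c + v j 0); nra.
  have [r00|rp] := eqVneq r 0.
    have [->|tn0] := eqVneq t 0; first by rewrite expr0n mulr_ge0.
    (* With [r = 0], [2 c t <= s] holds for every [c]. If [t] were nonzero, this choice would give
       [2 (s + 1) <= s]. *)
    have := hc (s / t + t^-1).
    rewrite r00 mulr0 add0r.
    have -> : 2 * (s / t + t^-1) * t = 2 * (s + 1) by field.
    by lra.
  have rgt0 : 0 < r by rewrite lt_neqAle eq_sym rp.
  (* The optimal [c], which turns the family of inequalities into [t ^ 2 <= r s]. *)
  have := hc (t / r).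
  have -> : 2 * (t / r) * t = 2 * (t ^+ 2 / r) by field.
  have -> : (t / r) ^+ 2 * r = t ^+ 2 / r by field.
  move=> h; have : t ^+ 2 / r <= s by lra.
  by rewrite ler_pdivrMr// mulrC.
rewrite /fro2; under eq_bigr do rewrite big_ord1.
apply: (@le_trans _ _ (\sum_i r * \sum_j `|B i j| * v j 0 ^+ 2)).
  by apply: ler_sum => i _; exact: row_le.
rewrite -mulr_sumr expr2 -mulrA ler_wpM2l// exchange_big/= mulr_sumr.
apply: ler_sum => j _; rewrite big_ord1 -mulr_suml ler_wpM2r ?sqr_ge0//.
Qed.

(** * Centering *)

Section centering.
Variable n : nat.

Definition center_mx : 'M[R]_n := 1%:M - n%:R^-1 *: const_mx 1.

Lemma center_mx_tr : center_mx^T = center_mx.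
Proof.
by apply/matrixP => i j; rewrite !mxE eq_sym.
Qed.

Lemma mul_center_mx p (C : 'M[R]_(n, p)) i j :
  (center_mx *m C) i j = C i j - n%:R^-1 * \sum_k C k j.
Proof.
rewrite mulmxBl mul1mx -scalemxAl !mxE; congr (_ - _ * _).
by apply: eq_bigr => k _; rewrite mxE mul1r.
Qed.

(** Pythagoras in each column: subtracting the mean removes [n] times its square. *)
Lemma fro2_center_mx p (C : 'M[R]_(n, p)) :
  fro2 (center_mx *m C) =
  fro2 C - n%:R^-1 * fro2 ((const_mx 1 : 'rV_n) *m C).
Proof.
(* For [n = 0] the default [0^-1 = 0] makes both corrections vanish. *)
have [n0|n0] := eqVneq (n%:R : R) 0.
  have e : center_mx *m C = C.
    by apply/matrixP => i j; rewrite mul_center_mx n0 invr0 mul0r subr0.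
  by rewrite e n0 invr0 mul0r subr0.
rewrite /fro2 big_ord1 exchange_big [in RHS]exchange_big/= mulr_sumr -sumrB.
apply: eq_bigr => j _.
have -> : ((const_mx 1 : 'rV_n) *m C) 0 j = \sum_k C k j.
  by rewrite mxE; apply: eq_bigr => k _; rewrite mxE mul1r.
set s := \sum_k C k j.
transitivity (\sum_i (C i j ^+ 2 + - (2 * n%:R^-1 * s) * C i j
    + (n%:R^-1 * s) ^+ 2)).
  by apply: eq_bigr => i _; rewrite mul_center_mx -/s; ring.
rewrite !big_split/= -mulr_sumr -/s sumr_const card_ord.
by rewrite -(mulr_natr (_ ^+ 2) n); field.
Qed.

Lemma center_mx_le p (C : 'M[R]_(n, p)) : fro2 (center_mx *m C) <= fro2 C.
Proof.
by rewrite fro2_center_mx lerBlDr lerDl mulr_ge0 ?fro2_ge0.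
Qed.

Lemma center_mx_idem : center_mx *m center_mx = center_mx.
Proof.
apply/matrixP => i j; rewrite mul_center_mx.
have [n0|n0] := eqVneq (n%:R : R) 0; first by rewrite n0 invr0 mul0r subr0.
rewrite [X in _ - _ * X](_ : _ = 0) ?mulr0 ?subr0//.
under eq_bigr do rewrite !mxE.
rewrite sumrB (bigD1 j)//= eqxx big1 ?addr0; last first.
  by move=> k /negbTE ->.
by rewrite sumr_const card_ord mulr1 -(mulr_natr n%:R^-1 n) mulVf ?subrr.
Qed.

(** Each centering loses [n^-1] times the squared norm of the column sums. By symmetry one loss is
    that of [K] itself; the other is that of the row [1 K] after centering, hence no larger. *)
Lemma fro2_center_both (K : 'M[R]_n) : K^T = K ->
  fro2 K - 2 / n%:R * fro2 ((const_mx 1 : 'rV_n) *m K)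
    <= fro2 (center_mx *m K *m center_mx) <= fro2 K.
Proof.
move=> symK.
have eKP : fro2 (K *m center_mx) = fro2 (center_mx *m K).
  by rewrite -fro2_tr trmx_mul symK center_mx_tr.
rewrite -mulmxA; apply/andP; split; last first.
  by rewrite (le_trans (center_mx_le _))// eKP center_mx_le.
rewrite fro2_center_mx eKP fro2_center_mx mulmxA.
set u := const_mx 1 *m K.
have : fro2 (u *m center_mx) <= fro2 u.
  by rewrite -fro2_tr trmx_mul center_mx_tr (le_trans (center_mx_le _))// fro2_tr.
have ni : 0 <= n%:R^-1 :> R by rewrite invr_ge0.
by move=> h; have := ler_wpM2l ni h; lra.
Qed.

End centering.
End frobenius.

(** * The triangular matrix of powers and the covariance of the process *)

Section autoregression_matrix.
Context {R : realFieldType} (alpha : R).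
Hypothesis alpha1 : `|alpha| < 1.
Local Notation a := `|alpha|.
Local Notation x := (alpha ^+ 2).

Lemma sqr_lt1 : 0 <= x < 1.
Proof.
by rewrite sqr_ge0 -(real_normK (num_real alpha)) expr_lt1.
Qed.

Lemma geometric_sum (y : R) m : y != 1 ->
  \sum_(k < m) y ^+ k = (1 - y ^+ m) / (1 - y).
Proof.
move=> y1; have y0 : 1 - y != 0 by rewrite subr_eq0 eq_sym.
apply: (mulIf y0); rewrite divfK// mulrC -[1 - y]opprB mulNr -subrX1.
by rewrite opprB.
Qed.

Lemma geometric_sum_le (y : R) m : 0 <= y -> y < 1 ->
  \sum_(k < m) y ^+ k <= (1 - y)^-1.
Proof.
move=> y0 y1; rewrite geometric_sum ?lt_eqF//; apply: ler_piMl.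
  by rewrite invr_ge0 subr_ge0 ltW.
by rewrite gerBl exprn_ge0.
Qed.

Definition ar_mx n : 'M[R]_n :=
  \matrix_(p, i) (if (i <= p)%N then alpha ^+ (p - i) else 0).

Lemma sum_row_shift (g : nat -> R) n p : (p < n)%N ->
  \sum_(i < n) (if (i <= p)%N then g (p - i)%N else 0) = \sum_(k < p.+1) g k.
Proof.
move=> pn; rewrite -(big_mkord xpredT (fun i => if (i <= p)%N then g (p - i)%N else 0)).
rewrite (@big_cat_nat _ _ _ p.+1)//= [X in _ + X]big_nat_cond [X in _ + X]big1.
  rewrite addr0 big_nat_rev/=; rewrite big_mkord; apply: eq_bigr => i _.
  rewrite add0n subSS leq_subr subKn//; by rewrite -ltnS.
by move=> i /andP[/andP[pi _] _]; rewrite leqNgt pi.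
Qed.

Lemma sum_col_shift (g : nat -> R) n i : (i < n)%N ->
  \sum_(p < n) (if (i <= p)%N then g (p - i)%N else 0) = \sum_(k < n - i) g k.
Proof.
move=> lin; rewrite -(big_mkord xpredT (fun p => if (i <= p)%N then g (p - i)%N else 0)).
rewrite (@big_cat_nat _ _ _ i)//=; last exact: ltnW.
rewrite [X in X + _]big_nat_cond big1 ?add0r; last first.
  by move=> p /andP[/andP[_ pi] _]; rewrite leqNgt pi.
rewrite -{1}(add0n i) big_addn big_mkord; apply: eq_bigr => k _.
by rewrite leq_addl addnK.
Qed.

Let normA n (p i : 'I_n) :
  `|ar_mx n p i| = if (i <= p)%N then a ^+ (p - i) else 0.
Proof. by rewrite mxE; case: ifP => _; rewrite ?normrX ?normr0. Qed.

Lemma ar_mx_row n (p : 'I_n) : \sum_i `|ar_mx n p i| <= (1 - a)^-1.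
Proof.
under eq_bigr do rewrite normA.
by rewrite (sum_row_shift (fun k => a ^+ k))// geometric_sum_le.
Qed.

Lemma ar_mx_col n (i : 'I_n) : \sum_p `|ar_mx n p i| <= (1 - a)^-1.
Proof.
under eq_bigr do rewrite normA.
by rewrite (sum_col_shift (fun k => a ^+ k))// geometric_sum_le.
Qed.

Lemma ar_mx_le n (v : 'cV_n) : fro2 (ar_mx n *m v) <= (1 - a)^-1 ^+ 2 * fro2 v.
Proof.
apply: schur_test; first by rewrite invr_ge0 subr_ge0 ltW.
  exact: ar_mx_row.
exact: ar_mx_col.
Qed.

Lemma ar_mx_tr_le n (v : 'cV_n) :
  fro2 ((ar_mx n)^T *m v) <= (1 - a)^-1 ^+ 2 * fro2 v.
Proof.
apply: schur_test; first by rewrite invr_ge0 subr_ge0 ltW.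
  by move=> i; under eq_bigr do rewrite mxE; exact: ar_mx_col.
by move=> i; under eq_bigr do rewrite mxE; exact: ar_mx_row.
Qed.

(** The column sums [(1 - alpha ^ m) / (1 - alpha)] are taken with their signs, so that the
    denominator is [1 - alpha], as in [C2], and not [1 - |alpha|]. The [4] bounds
    [(1 - alpha ^ m) ^ 2]. *)
Lemma fro2_ar_mx_colsum n :
  fro2 ((const_mx 1 : 'rV_n) *m ar_mx n) <= n%:R * (4 / (1 - alpha) ^+ 2).
Proof.
rewrite /fro2 big_ord1 mulr_natl -[X in _ *+ X](card_ord n) -sumr_const.
apply: ler_sum => i _.
have -> : ((const_mx 1 : 'rV_n) *m ar_mx n) 0 i = \sum_(k < n - i) alpha ^+ k.
  rewrite mxE -(sum_col_shift (fun k => alpha ^+ k))//.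
  by apply: eq_bigr => p _; rewrite !mxE mul1r.
have an1 : alpha != 1 by apply: contraTneq alpha1 => ->; rewrite normr1 ltxx.
rewrite geometric_sum// expr_div_n ler_wpM2r ?invr_ge0 ?sqr_ge0//.
have : `|alpha ^+ (n - i)| <= 1 by rewrite normrX exprn_ile1// ltW.
by rewrite ler_norml => /andP[h1 h2]; nra.
Qed.

(* Covariance of [X_(i+1)] and [X_(j+1)]. *)
Definition ar_cov (i j : nat) : R :=
  alpha ^+ ((i - j) + (j - i)) * ((1 - x ^+ (minn i j).+1) / (1 - x)).

Lemma ar_covC i j : ar_cov i j = ar_cov j i.
Proof. by rewrite /ar_cov addnC minnC. Qed.

Lemma ar_mx_mul_tr n (i j : 'I_n) : (ar_mx n *m (ar_mx n)^T) i j = ar_cov i j.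
Proof.
wlog ji : i j / (j <= i)%N.
  move=> H; have [/H//|/ltnW/H] := leqP j i.
  by rewrite ar_covC => <-; rewrite !mxE; apply: eq_bigr => k _; rewrite !mxE mulrC.
have /andP[_ x1] := sqr_lt1.
rewrite /ar_cov (minn_idPr ji) (eqP ji) addn0 -geometric_sum ?lt_eqF//.
rewrite -(sum_row_shift (fun k => x ^+ k) (ltn_ord j)) mulr_sumr mxE.
apply: eq_bigr => k _; rewrite !mxE; case: (leqP k j) => kj; last by rewrite !mulr0.
rewrite (leq_trans kj ji) -exprM -!exprD; congr (_ ^+ _).
by rewrite mul2n -addnn addnA; congr (_ + _)%N; rewrite addnBA// subnK.
Qed.

(** Up to the factor [(1 - x) ^ 2], [w k] is the squared variance of [X_(k+1)], and [s n] is the sum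
    of the squared covariances of [X_(n+1)] with [X_1, ..., X_n]. *)
Let w k : R := (1 - x ^+ k.+1) ^+ 2.
Let s n : R := \sum_(i < n) x ^+ (n - i) * w i.

Let sS n : s n.+1 = x * (s n + w n).
Proof.
rewrite /s big_ord_recr/= subSnn expr1 mulrDr; congr (_ + _).
rewrite mulr_sumr; apply: eq_bigr => i _.
by rewrite subSn 1?ltnW// exprS mulrA.
Qed.

Let w01 k : 0 <= w k <= 1.
Proof.
have /andP[x0 x1] := sqr_lt1.
have y0 : 0 <= x ^+ k.+1 by exact: exprn_ge0.
have y1 : x ^+ k.+1 <= 1 by rewrite exprn_ile1// ltW.
by rewrite /w sqr_ge0/=; move: (x ^+ k.+1) y0 y1 => y y0 y1; nra.
Qed.

(** The upper bound is the fixed point of [t -> x (t + 1)], which dominates the recurrence [sS]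
    because [w n <= 1]. *)
Let s0 n : 0 <= s n <= x / (1 - x).
Proof.
have /andP[x0 x1] := sqr_lt1.
elim: n => [|n /andP[IH0 IH1]].
  by rewrite /s big_ord0 lexx divr_ge0// subr_ge0 ltW.
have /andP[w0 w1] := w01 n.
rewrite sS mulr_ge0 ?addr_ge0//=.
have xp : 0 < 1 - x by rewrite subr_gt0.
rewrite ler_pdivlMr// in IH1; rewrite ler_pdivlMr//.
have : (s n + w n) * (1 - x) <= 1 by nra.
by move=> h; rewrite -mulrA -[leRHS]mulr1 ler_wpM2l.
Qed.

Let ar_cov_sqr n i : (i < n)%N ->
  ar_cov n i ^+ 2 = x ^+ (n - i) * w i / (1 - x) ^+ 2.
Proof.
move=> lin; rewrite /ar_cov (minn_idPr (ltnW lin)) (eqP (ltnW lin)) addn0.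
rewrite exprMn expr_div_n -/(w i) mulrA; congr (_ * _ / _).
by rewrite -!exprM mulnC.
Qed.

(** An exact evaluation of the double sum: the new row and column contribute
    [(2 s n + w n) / (1 - x) ^ 2], and the recurrence [sS] makes the terms in [s] telescope to a
    bounded boundary term. *)
Let frobenius_covE n :
  (1 - x) ^+ 3 * \sum_(i < n) \sum_(j < n) ar_cov i j ^+ 2 =
  (1 + x) * \sum_(m < n) w m - 2 * s n.
Proof.
have /andP[x0 x1] := sqr_lt1.
have xp : 1 - x != 0 by rewrite gt_eqF// subr_gt0.
elim: n => [|n IHn]; first by rewrite /s !big_ord0 !mulr0 subr0.
have -> : \sum_(i < n.+1) \sum_(j < n.+1) ar_cov i j ^+ 2 =
    \sum_(i < n) \sum_(j < n) ar_cov i j ^+ 2 +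
    2 * (\sum_(i < n) ar_cov n i ^+ 2) + ar_cov n n ^+ 2.
  rewrite big_ord_recr/=.
  under eq_bigr do rewrite big_ord_recr/=.
  rewrite big_split/= [X in _ + X]big_ord_recr/= !addrA; congr (_ + _).
  rewrite -addrA; congr (_ + _); rewrite -big_split/= mulr_sumr.
  by apply: eq_bigr => i _; rewrite (ar_covC i n); ring.
have -> : \sum_(i < n) ar_cov n i ^+ 2 = s n / (1 - x) ^+ 2.
  by rewrite /s mulr_suml; apply: eq_bigr => i _; rewrite ar_cov_sqr.
have -> : ar_cov n n ^+ 2 = w n / (1 - x) ^+ 2.
  by rewrite /ar_cov minnn subnn addn0 expr0 mul1r expr_div_n.
rewrite !mulrDr IHn sS big_ord_recr/=; field.
exact: xp.
Qed.

(** Expanding the squares gives the sum exactly. The subtracted constant is the limit of the deficit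
    [n - sum w], which increases with [n]. *)
Let sum_w_ge n :
  n%:R - (2 * x / (1 - x) - x ^+ 2 / (1 - x ^+ 2)) <= \sum_(m < n) w m.
Proof.
have /andP[x0 x1] := sqr_lt1.
have xp : 0 < 1 - x by rewrite subr_gt0.
have xq : 0 < 1 - x ^+ 2 by nra.
suff -> : \sum_(m < n) w m = n%:R -
    (2 * x * (1 - x ^+ n) / (1 - x) -
     x ^+ 2 * (1 - (x ^+ n) ^+ 2) / (1 - x ^+ 2)).
  rewrite -subr_ge0.
  set y := x ^+ n; have y0 : 0 <= y by exact: exprn_ge0.
  have y1 : y <= 1 by rewrite exprn_ile1// ltW.
  have -> : n%:R - (2 * x * (1 - y) / (1 - x)
      - x ^+ 2 * (1 - y ^+ 2) / (1 - x ^+ 2))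
      - (n%:R - (2 * x / (1 - x) - x ^+ 2 / (1 - x ^+ 2))) =
      x * y * (2 * (1 + x) - x * y) / (1 - x ^+ 2).
    by field; rewrite !gt_eqF// -exprM.
  have xy : x * y <= 1 by rewrite mulr_ile1// ltW.
  apply: divr_ge0; last exact: ltW.
  by apply: mulr_ge0; [exact: mulr_ge0|lra].
elim: n => [|n IHn].
  by rewrite big_ord0 expr0 expr1n subrr !mulr0 !mul0r !subr0.
rewrite big_ord_recr/= IHn /w -natr1 !exprS.
by field; rewrite !gt_eqF// -exprM.
Qed.

Lemma fro2_ar_cov_bounds n :
  n%:R * ((1 + x) / (1 - x) ^+ 3) - (4 * x + x ^+ 2) / (1 - x) ^+ 4
    <= fro2 (ar_mx n *m (ar_mx n)^T) <= n%:R * ((1 + x) / (1 - x) ^+ 3).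
Proof.
have /andP[x0 x1] := sqr_lt1.
have xp : 0 < 1 - x by rewrite subr_gt0.
have xq : 0 < 1 + x by rewrite ltr_pwDl.
have -> : fro2 (ar_mx n *m (ar_mx n)^T) =
    ((1 + x) * \sum_(m < n) w m - 2 * s n) / (1 - x) ^+ 3.
  rewrite -frobenius_covE [RHS]mulrAC divff ?mul1r ?gt_eqF ?exprn_gt0//.
  by apply: eq_bigr => i _; apply: eq_bigr => j _; rewrite ar_mx_mul_tr.
have /andP[s1 s2] := s0 n.
have w_le : \sum_(m < n) w m <= n%:R.
  rewrite -[X in _ <= X%:R](card_ord n) -sumr_const; apply: ler_sum => i _.
  by case/andP: (w01 i).
have xi : 0 <= ((1 - x) ^+ 3)^-1 by rewrite invr_ge0 exprn_ge0// ltW.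
apply/andP; split; last first.
  by rewrite mulrA ler_wpM2r//; nra.
(* The deficit in the sum of [w], multiplied by [1 + x], and the boundary term [2 x / (1 - x)] add
   up to [(4 x + x ^ 2) / (1 - x)]; this is the origin of the second term of [C2]. *)
have -> : n%:R * ((1 + x) / (1 - x) ^+ 3) - (4 * x + x ^+ 2) / (1 - x) ^+ 4
    = ((1 + x) * (n%:R - (2 * x / (1 - x) - x ^+ 2 / (1 - x ^+ 2)))
       - 2 * (x / (1 - x))) / (1 - x) ^+ 3.
  by field; rewrite !gt_eqF//; nra.
rewrite ler_wpM2r// lerB ?ler_wpM2l ?(ltW xq)//.
Qed.

End autoregression_matrix.

(** * Norms of the centred matrix, compared with [C2] and [C3] *)

Section covariance_matrix.
Context {R : realType} (alpha : R).
Hypothesis alpha1 : `|alpha| < 1.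
Local Notation a := `|alpha|.
Local Notation x := (alpha ^+ 2).

Definition cov_mx n : 'M[R]_n :=
  (ar_mx alpha n)^T *m center_mx n *m ar_mx alpha n.

Lemma cov_mx_tr n : (cov_mx n)^T = cov_mx n.
Proof. by rewrite /cov_mx !trmx_mul trmxK center_mx_tr mulmxA. Qed.

Lemma cov_mx_le n (v : 'cV_n) :
  fro2 (cov_mx n *m v) <= (1 - a)^-1 ^+ 4 * fro2 v.
Proof.
rewrite /cov_mx -!mulmxA; have ai : 0 <= (1 - a)^-1 ^+ 2 by exact: sqr_ge0.
apply: (le_trans (ar_mx_tr_le alpha1 _)).
rewrite -[4%N]/(2 + 2)%N exprD -mulrA ler_wpM2l//.
by rewrite (le_trans (center_mx_le _))// ar_mx_le.
Qed.

(** Cyclicity of the trace and idempotence of the centering. This replaces [A^T C A] by a centred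
    version of [A A^T], whose entries are known in closed form. *)
Lemma fro2_cov_mx n :
  fro2 (cov_mx n) =
  fro2 (center_mx n *m (ar_mx alpha n *m (ar_mx alpha n)^T) *m center_mx n).
Proof.
rewrite !fro2_trace cov_mx_tr /cov_mx.
set A := ar_mx alpha n; set C := center_mx n.
have -> : (C *m (A *m A^T) *m C)^T = C *m (A *m A^T) *m C.
  by rewrite !trmx_mul trmxK center_mx_tr !mulmxA.
have CC : C *m C = C by exact: center_mx_idem.
transitivity (\tr (A *m A^T *m C *m (A *m A^T) *m C)).
  rewrite -!mulmxA mxtrace_mulC -!mulmxA mxtrace_mulC -!mulmxA.
  rewrite mxtrace_mulC -!mulmxA mxtrace_mulC -!mulmxA mxtrace_mulC -!mulmxA.
  by [].
by rewrite [RHS]mxtrace_mulC !mulmxA -(mulmxA _ C C) CC mxtrace_mulC !mulmxA CC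
  -[LHS]mxtrace_mulC !mulmxA.
Qed.

(** The cost of centering does not grow with [n]: the row [1 A] has squared norm at most
    [4 n / (1 - alpha) ^ 2], the remaining factor contributes [(1 - a) ^ -2], and the prefactor is
    [2 / n]. *)
Lemma fro2_cov_mx_bounds n : (0 < n)%N ->
  n%:R * ((1 + x) / (1 - x) ^+ 3) -
    ((4 * x + x ^+ 2) / (1 - x) ^+ 4 + 8 / ((1 - alpha) ^+ 2 * (1 - a) ^+ 2))
  <= fro2 (cov_mx n) <= n%:R * ((1 + x) / (1 - x) ^+ 3).
Proof.
move=> n0; have n0' : (n%:R : R) != 0 by rewrite pnatr_eq0 -lt0n.
have /andP[k1 k2] := fro2_ar_cov_bounds alpha1 n.
rewrite fro2_cov_mx; set K := ar_mx alpha n *m _ in k1 k2 *.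
have symK : K^T = K by rewrite /K trmx_mul trmxK.
have /andP[c1 c2] := fro2_center_both symK.
rewrite (le_trans c2 k2) andbT; apply: le_trans c1.
rewrite opprD addrA; apply: lerB; first exact: k1.
have hs : fro2 ((const_mx 1 : 'rV_n) *m K) <=
    (1 - a)^-1 ^+ 2 * (n%:R * (4 / (1 - alpha) ^+ 2)).
  rewrite -fro2_tr trmx_mul symK /K -mulmxA.
  apply: (le_trans (ar_mx_le alpha1 _)); rewrite ler_wpM2l ?sqr_ge0//.
  by rewrite -trmx_mul fro2_tr; exact: fro2_ar_mx_colsum.
have nn : 0 <= 2 / n%:R :> R by rewrite divr_ge0.
apply: (le_trans (ler_wpM2l nn hs)).
have a1 : 1 - a != 0 by rewrite gt_eqF// subr_gt0.
have al1 : 1 - alpha != 0.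
  by apply: contraTneq alpha1 => /eqP; rewrite subr_eq0 => /eqP <-; rewrite normr1 ltxx.
by rewrite le_eqVlt; apply/orP; left; apply/eqP; field; rewrite n0' a1 al1.
Qed.

Lemma fro2_cov_mx_sqr_le n :
  fro2 ((cov_mx n)^T *m cov_mx n) <= (1 - a)^-1 ^+ 4 * fro2 (cov_mx n).
Proof. by rewrite cov_mx_tr; apply: fro2_mulmx_le => v; exact: cov_mx_le. Qed.

Lemma cov_mx1 : cov_mx 1 = 0.
Proof.
rewrite /cov_mx (_ : center_mx 1 = 0) ?mulmx0 ?mul0mx//.
by apply/matrixP => i j; rewrite !ord1 !mxE eqxx invr1 mulr1 subrr.
Qed.

(** The third and fourth terms of [C2] add up to the centering cost because
    [1 - x = (1 - a) (1 + a)]; the first and last terms are nonnegative. *)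
Lemma C2_ge : (4 * x + x ^+ 2) / (1 - x) ^+ 4
    + 8 / ((1 - alpha) ^+ 2 * (1 - a) ^+ 2) <= C2 alpha.
Proof.
have /andP[x0 x1] := sqr_lt1 alpha1.
have a1 : 1 - a != 0 by rewrite gt_eqF// subr_gt0.
have al1 : 1 - alpha != 0.
  by apply: contraTneq alpha1 => /eqP; rewrite subr_eq0 => /eqP <-; rewrite normr1 ltxx.
have x1' : 1 - x != 0 by rewrite gt_eqF// subr_gt0.
have xa : 1 - x = (1 - a) * (1 + a).
  by rewrite -(real_normK (num_real alpha)); ring.
have ap : 1 + a != 0 by rewrite gt_eqF// ltr_pwDl.
rewrite /C2; set sp := sup _.
have sp0 : 0 <= sp.
  rewrite /sp; set E := [set _ | _ in _].
  (* Without a supremum, [sup] takes the default value [0]; otherwise the element at [m = 1] is a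
     nonnegative lower bound for it. *)
  have [hE|hE] := pselect (has_sup E); last by rewrite sup_out.
  apply: (le_trans (y := 1%:R * alpha ^+ (2 * 1 + 2))).
    by rewrite mul1r exprn_even_ge0.
  by apply: ub_le_sup; [exact: (proj2 hE)|exists 1%N].
have t1 : 0 <= 4 / (1 - x) ^+ 3 * sp.
  by rewrite mulr_ge0// divr_ge0// exprn_ge0// subr_ge0 ltW.
have t5 : 0 <= 16 / (1 - alpha) ^+ 4 by rewrite divr_ge0// exprn_even_ge0.
have e : 8 / ((1 - alpha) ^+ 2 * (1 - a) ^+ 2) =
    8 / ((1 - alpha) ^+ 2 * (1 - x)) +
    16 * a / ((1 - a) * (1 - alpha) ^+ 2 * (1 - x)).
  by rewrite xa; field; rewrite a1 al1 ap.
by rewrite e; lra.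
Qed.

Lemma powR_four_thirds (y : R) : 0 <= y -> y `^ (4 / 3) ^+ 3 = y ^+ 4.
Proof.
move=> y0; rewrite -powR_mulrn ?powR_ge0// -powRrM -powR_mulrn//.
by congr (_ `^ _); field.
Qed.

(* With [t = y `^ (1/3)] this is [3 t ^ 4 - 4 t ^ 3 + 1 =
   (t - 1) ^ 2 (3 t ^ 2 + 2 t + 1) >= 0]. *)
Lemma one_sub_powR_four_thirds (y : R) : 0 <= y ->
  1 - y `^ (4 / 3) <= 4 / 3 * (1 - y).
Proof.
move=> y0; set t := y `^ (1 / 3).
have t0 : 0 <= t by exact: powR_ge0.
have t3 : t ^+ 3 = y.
  rewrite /t -powR_mulrn ?powR_ge0// -powRrM.
  by rewrite (_ : 1 / 3 * 3%:R = 1) ?powRr1//; field.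
have t4 : y `^ (4 / 3) = t ^+ 4.
  rewrite /t -(powR_mulrn 4) ?powR_ge0// -powRrM.
  by congr (_ `^ _); field.
rewrite t4 -t3.
have : 0 <= (t - 1) ^+ 2 * (3 * t ^+ 2 + 2 * t + 1).
  by rewrite mulr_ge0 ?sqr_ge0// !addr_ge0 ?mulr_ge0 ?sqr_ge0.
have -> : (t - 1) ^+ 2 * (3 * t ^+ 2 + 2 * t + 1) = 3 * t ^+ 4 - 4 * t ^+ 3 + 1.
  by ring.
by lra.
Qed.

(** Only the first summand under the cube is kept, with value
    [16 / ((1 - x) ^ 4 (1 - a ^ (4/3)) ^ 3)]; bounding [1 - a ^ (4/3)] by [4 / 3 (1 - a)] gives
    [16 * 27 / 64 = 27 / 4]. *)
Lemma C3_ge : 27 / 4 / ((1 - x) ^+ 4 * (1 - a) ^+ 3) <= C3 alpha.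
Proof.
have /andP[x0 x1] := sqr_lt1 alpha1.
have xp : 0 < 1 - x by rewrite subr_gt0.
have ap : 0 < 1 - a by rewrite subr_gt0.
have alp : 0 <= 1 - alpha by rewrite subr_ge0 (le_trans (ler_norm _))// ltW.
have d0 : 0 < 1 - a `^ (4 / 3).
  have p1 : 1 `^ (4 / 3) = 1 :> R by rewrite powR1.
  rewrite subr_gt0 -[X in _ < X]p1 lt_neqAle; apply/andP; split.
    apply: contraTneq alpha1 => h; rewrite -leNgt.
    have := powR_four_thirds (normr_ge0 alpha).
    rewrite h p1 expr1n => /esym/eqP; rewrite pexpr_eq1// => /eqP ->.
    exact: lexx.
  by apply: ge0_ler_powR; rewrite ?nnegrE// ltW.
rewrite /C3; set v := 16 / _; have v0 : 0 <= v by rewrite divr_ge0// powR_ge0.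
set u := (X in X + v); have u0 : 0 <= u.
  apply: divr_ge0; first exact: powR_ge0.
  by apply: mulr_ge0; [exact: powR_ge0|exact: ltW].
apply: (@le_trans _ _ (u ^+ 3)); last first.
  by rewrite lerXn2r ?nnegrE ?addr_ge0// lerDl.
rewrite /u expr_div_n exprMn !powR_four_thirds//; last exact: ltW.
have := one_sub_powR_four_thirds (normr_ge0 alpha).
move: (a `^ (4 / 3)) d0 => z d0 hz.
have h3 : (1 - z) ^+ 3 <= (4 / 3 * (1 - a)) ^+ 3.
  apply: lerXn2r => //; rewrite nnegrE; first exact: ltW.
  by apply: mulr_ge0 => //; exact: ltW.
have x4 : 0 < (1 - x) ^+ 4 by rewrite exprn_gt0.
have e : 27 / 4 / ((1 - x) ^+ 4 * (1 - a) ^+ 3) =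
    2 ^+ 4 / ((1 - x) ^+ 4 * (4 / 3 * (1 - a)) ^+ 3).
  by field; rewrite !gt_eqF.
rewrite e ler_wpM2l ?exprn_ge0// lef_pV2 ?posrE ?mulr_gt0 ?exprn_gt0//.
by rewrite ler_wpM2l// ltW.
Qed.

(** After multiplication by [(1 - x) ^ 4 (1 - a) ^ 3] the claim reads
    [2 (1 + x) (1 + a) <= r + 27 / 4], where [27 / 4] comes from [C3] and [r] from the second term
    of [C2]. *)
Lemma trace_constant_le :
  2 * ((1 - a)^-1 ^+ 4 * ((1 + x) / (1 - x) ^+ 3)) <= C2 alpha ^+ 2 / 2 + C3 alpha.
Proof.
have /andP[x0 x1] := sqr_lt1 alpha1.
have a0 := normr_ge0 alpha.
have xp : 0 < 1 - x by rewrite subr_gt0.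
have ap : 0 < 1 - a by rewrite subr_gt0.
have xE : x = a ^+ 2 by rewrite real_normK ?num_real.
have c2 := C2_ge; have c3 := C3_ge.
have h8 : 0 <= 8 / ((1 - alpha) ^+ 2 * (1 - a) ^+ 2).
  by rewrite divr_ge0// mulr_ge0 ?sqr_ge0.
have q0 : 0 <= (4 * x + x ^+ 2) / (1 - x) ^+ 4.
  apply: divr_ge0; last exact/exprn_ge0/ltW.
  by apply: addr_ge0; [exact: mulr_ge0|exact: sqr_ge0].
have c2' : ((4 * x + x ^+ 2) / (1 - x) ^+ 4) ^+ 2 <= C2 alpha ^+ 2.
  by rewrite lerXn2r ?nnegrE//; lra.
apply: (@le_trans _ _ (((4 * x + x ^+ 2) / (1 - x) ^+ 4) ^+ 2 / 2 +
    27 / 4 / ((1 - x) ^+ 4 * (1 - a) ^+ 3))); last by lra.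
have x4 : 0 < (1 - x) ^+ 4 * (1 - a) ^+ 3 by rewrite mulr_gt0 ?exprn_gt0.
have xa : 1 - x = (1 - a) * (1 + a) by rewrite xE; ring.
have oa : 0 < 1 + a by rewrite ltr_pwDl.
have -> : 2 * ((1 - a)^-1 ^+ 4 * ((1 + x) / (1 - x) ^+ 3)) =
    2 * (1 + x) * (1 + a) / ((1 - x) ^+ 4 * (1 - a) ^+ 3).
  by rewrite xa; field; rewrite !gt_eqF.
have -> : ((4 * x + x ^+ 2) / (1 - x) ^+ 4) ^+ 2 / 2 =
    ((4 * x + x ^+ 2) ^+ 2 / 2 / ((1 - a) * (1 + a) ^+ 4))
      / ((1 - x) ^+ 4 * (1 - a) ^+ 3).
  by rewrite xa; field; rewrite !gt_eqF.
rewrite -mulrDl ler_wpM2r ?invr_ge0 ?(ltW x4)//.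
(* Up to [17 / 20] the left side stays below [27 / 4]. Beyond, it is at most [8 = 27 / 4 + 5 / 4],
   and [r], which contains [1 / (1 - a)], exceeds [5 / 4]. *)
case: (leP a (17 / 20)) => ha.
  have r0 : 0 <= (4 * x + x ^+ 2) ^+ 2 / 2 / ((1 - a) * (1 + a) ^+ 4).
    by rewrite !divr_ge0 ?sqr_ge0// mulr_ge0 ?exprn_ge0// ltW.
  have x2 : x <= (17 / 20) ^+ 2 by rewrite xE lerXn2r ?nnegrE.
  by nra.
have x2 : (17 / 20) ^+ 2 <= x by rewrite xE lerXn2r ?nnegrE ?(ltW ha).
have r1 : 5 / 4 <= (4 * x + x ^+ 2) ^+ 2 / 2 / ((1 - a) * (1 + a) ^+ 4).
  rewrite ler_pdivlMr ?mulr_gt0 ?exprn_gt0//.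
  have h16 : (1 + a) ^+ 4 <= 2 ^+ 4 by rewrite lerXn2r ?nnegrE; lra.
  have h20 : 0 <= (1 + a) ^+ 4 by rewrite exprn_ge0// ltW.
  have hm : (1 - a) * (1 + a) ^+ 4 <= 3 / 20 * 2 ^+ 4.
    by apply: ler_pM => //; lra.
  have hx : 3 <= 4 * x + x ^+ 2 by nra.
  by nra.
by nra.
Qed.

End covariance_matrix.

(** * The empirical covariance *)

Section normal_approximation.
Context (R : realType) (d : measure_display) (T : measurableType d)
  (P : probability T R) (alpha : R).
Hypothesis alpha1 : `|alpha| < 1.
Local Notation x := (alpha ^+ 2).
Local Notation c2 := ((1 - x) ^+ 3 / (1 + x)).

Lemma ar1E (xi : nat -> {RV P >-> R}) k w :
  ar1 alpha xi k.+1 w = \sum_(i < k.+1) alpha ^+ (k - i) * xi i w.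
Proof.
elim: k => [|k IHk]; first by rewrite big_ord1 /= mulr0 add0r mul1r.
rewrite [LHS]/= -/(ar1 alpha xi k.+1 w) IHk [RHS]big_ord_recr/= subnn mul1r.
congr (_ + _); rewrite mulr_sumr; apply: eq_bigr => i _.
by rewrite mulrA -exprS subSn// -ltnS.
Qed.

Lemma ar1_mx (xi : nat -> {RV P >-> R}) n w (p : 'I_n) :
  ar1 alpha xi p.+1 w = (ar_mx alpha n *m \col_i xi i w) p 0.
Proof.
rewrite ar1E mxE (big_ord_widen n (fun i => alpha ^+ (p - i) * xi i w))//.
rewrite big_mkcond; apply: eq_bigr => i _; rewrite !mxE ltnS.
by case: ifP => _; rewrite ?mul0r.
Qed.

Lemma Z12_mx (xi eta : nat -> {RV P >-> R}) n w :
  Z12 alpha xi eta n w =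
  n%:R^-1 * \sum_(i < n) xi i w * \sum_(j < n) cov_mx alpha n i j * eta j w.
Proof.
pose u : 'cV[R]_n := \col_i xi i w; pose v : 'cV[R]_n := \col_i eta i w.
pose X := ar_mx alpha n *m u; pose Y := ar_mx alpha n *m v.
transitivity (n%:R^-1 * (X^T *m (center_mx n *m Y)) 0 0).
  rewrite /Z12 !big_add1 succnK !big_mkord.
  rewrite mxE; under [in RHS]eq_bigr do rewrite mul_center_mx mulrBr mxE.
  rewrite sumrB -mulr_suml mulrBr !mul1r -exprVn expr2; congr (_ - _).
    by congr (_ * _); apply: eq_bigr => p _; rewrite !ar1_mx.
  rewrite -!mulrA; congr (_ * _); rewrite mulrCA; congr (_ * _).
    by apply: eq_bigr => p _; rewrite ar1_mx.
  by congr (_ * _); apply: eq_bigr => p _; rewrite ar1_mx.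
congr (_ * _).
have -> : X^T *m (center_mx n *m Y) = u^T *m (cov_mx alpha n *m v).
  by rewrite /X /Y /cov_mx trmx_mul !mulmxA.
rewrite mxE; apply: eq_bigr => i _; rewrite !mxE; congr (_ * _).
by apply: eq_bigr => j _; rewrite !mxE.
Qed.

Lemma c2_gt0 : 0 < c2.
Proof.
have /andP[x0 x1] := sqr_lt1 alpha1.
by rewrite divr_gt0 ?exprn_gt0 ?subr_gt0// ltr_pwDl.
Qed.

(** The left side is [E (1 - S ^ 2) ^ 2], split into squared bias and variance. As [c2] is the
    inverse of the leading coefficient [B], the bias is [c2 D / n], where [D] is the deficit bounded
    by [C2]. *)
Lemma variance_bound n : (0 < n)%N ->
  (1 - c2 / n%:R * fro2 (cov_mx alpha n)) ^+ 2
  + 2 * (c2 / n%:R) ^+ 2 * fro2 ((cov_mx alpha n)^T *m cov_mx alpha n)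
  <= (C4 alpha / Num.sqrt n%:R) ^+ 2.
Proof.
move=> n0; have np : 0 < n%:R :> R by rewrite ltr0n.
have /andP[x0 x1] := sqr_lt1 alpha1.
have /andP[lo up] := fro2_cov_mx_bounds alpha1 n0.
have hC2 := C2_ge alpha1; have hC3 := C3_ge alpha1.
have ap : 0 < 1 - `|alpha| by rewrite subr_gt0.
have xp : 0 < 1 - x by rewrite subr_gt0.
have xq : 0 < 1 + x by rewrite ltr_pwDl.
have C30 : 0 <= C3 alpha.
  apply: le_trans hC3; apply: divr_ge0 => //.
  by rewrite mulr_ge0// exprn_ge0// ltW.
have trc := trace_constant_le alpha1.
have hsq := fro2_cov_mx_sqr_le alpha1 n.
have -> : (C4 alpha / Num.sqrt n%:R) ^+ 2 =
    c2 ^+ 2 * (C2 alpha ^+ 2 + C3 alpha) / n%:R.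
  by rewrite /C4 expr_div_n exprMn !sqr_sqrtr ?ler0n ?addr_ge0 ?sqr_ge0.
set B := (1 + x) / (1 - x) ^+ 3 in lo up trc.
have cB : c2 * B = 1 by rewrite /B; field; rewrite !gt_eqF.
set F := fro2 (cov_mx alpha n) in lo up hsq *.
set G := fro2 (_ *m _) in hsq *.
have G0 : 0 <= G by exact: fro2_ge0.
set D := n%:R * B - F.
have D0 : 0 <= D by rewrite subr_ge0.
have D1 : D <= C2 alpha by rewrite /D; lra.
have -> : 1 - c2 / n%:R * F = c2 * (D / n%:R).
  transitivity (c2 * B - c2 / n%:R * F); first by rewrite cB.
  by rewrite /D; field; rewrite !gt_eqF.
have -> : (c2 * (D / n%:R)) ^+ 2 + 2 * (c2 / n%:R) ^+ 2 * G =
    c2 ^+ 2 * (D ^+ 2 + 2 * G) / n%:R ^+ 2.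
  by field; rewrite !gt_eqF.
have D2 : D ^+ 2 <= C2 alpha ^+ 2 by rewrite lerXn2r ?nnegrE// (le_trans D0).
rewrite [leLHS]mulrAC.
have -> : c2 ^+ 2 * (C2 alpha ^+ 2 + C3 alpha) / n%:R =
    c2 ^+ 2 / n%:R ^+ 2 * (n%:R * (C2 alpha ^+ 2 + C3 alpha)).
  by field; rewrite !gt_eqF.
rewrite ler_wpM2l ?divr_ge0 ?sqr_ge0//.
(* For [n = 1] the matrix vanishes; for [n >= 2] the slack [C2 ^ 2 / 2] absorbs
   the part of [2 * G] that exceeds [n * C3]. *)
have [n1|n2] := leqP n 1.
  have nE : n = 1%N by apply/eqP; rewrite eqn_leq n1.
  have -> : G = 0.
    rewrite /G nE cov_mx1 mulmx0.
    by apply: big1 => i _; apply: big1 => j _; rewrite mxE expr0n.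
  by rewrite nE mulr0 addr0 mul1r; lra.
have n2' : 2 <= n%:R :> R by rewrite ler_nat.
have GB : 2 * G <= n%:R * (C2 alpha ^+ 2 / 2 + C3 alpha).
  apply: (@le_trans _ _ (n%:R * (2 * ((1 - `|alpha|)^-1 ^+ 4 * B)))); last first.
    by rewrite ler_wpM2l// ltW.
  rewrite mulrCA ler_pM2l//; apply: (le_trans hsq).
  by rewrite mulrCA ler_wpM2l// exprn_ge0// invr_ge0 ltW.
have := sqr_ge0 (C2 alpha); nra.
Qed.

Context (xi eta : nat -> {RV P >-> R}).
Hypothesis hnoise : iid_standard_normal_noises xi eta.

Let V := sum_family xi eta.

Let indepV : mutually_independent V. Proof. by case: hnoise. Qed.

Let normalV i (A : set R) : measurable A ->
  distribution P (V i) A = normal_prob 0 1 A.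
Proof. by case: hnoise => h1 h2 _ mA; case: i => i; [exact: h1|exact: h2]. Qed.

(** * The conditional Gaussian structure for a fixed sample size *)

Section fixed_size.
Variable n : nat.

(** The linear and quadratic forms take coefficients indexed by natural numbers; [inord] provides
    them, and the size [n.+1] makes the index type inhabited. *)
Let m (i j : nat) : R := cov_mx alpha n.+1 (inord i) (inord j).
Let Q (j k : nat) : R := \sum_(i < n.+1) m i j * m i k.
Let c := Num.sqrt c2 * Num.sqrt n.+1%:R.
(** Coefficient of [xi i] in the rescaled covariance. It depends on [eta] alone, so it stays fixed
    while any [xi] is resampled. *)
Let b (i : nat) (w : T) : R := c / n.+1%:R * linear_form V inr (m i) n.+1 w.
Let S (w : T) : R := Num.sqrt (\sum_(i < n.+1) b i w ^+ 2).
Let W : {RV P >-> R} := scale_mfun c (Z12 alpha xi eta n.+1).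

Let WE w : W w = \sum_(i < n.+1) b i w * V (inl (nat_of_ord i)) w.
Proof.
rewrite /W/= Z12_mx mulrC mulrA mulr_sumr; apply: eq_bigr => i _.
rewrite /b [RHS]mulrAC -[RHS]mulrA; congr (_ * (_ * _)).
by apply: eq_bigr => j _; rewrite /m !inord_val.
Qed.

Let cn2 : (c / n.+1%:R) ^+ 2 = c2 / n.+1%:R.
Proof.
rewrite /c expr_div_n exprMn !sqr_sqrtr ?ler0n ?(ltW c2_gt0)//.
by move: c2 => k; rewrite expr2 invfM mulrA mulfK ?pnatr_eq0.
Qed.

Let S2E w : S w ^+ 2 = c2 / n.+1%:R * quadratic_form V inr Q n.+1 w.
Proof.
rewrite /S sqr_sqrtr; last by apply: sumr_ge0 => i _; exact: sqr_ge0.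
rewrite /b; under eq_bigr do rewrite exprMn cn2.
rewrite -mulr_sumr; congr (_ * _); rewrite /quadratic_form /Q.
under [RHS]eq_bigr => j _ do under eq_bigr => k _ do rewrite !mulr_suml.
under [RHS]eq_bigr => j _ do rewrite exchange_big/=.
rewrite [RHS]exchange_big/=; apply: eq_bigr => i _.
rewrite expr2 /linear_form mulr_suml; apply: eq_bigr => j _.
rewrite mulr_sumr; apply: eq_bigr => k _; ring.
Qed.

Let momentsS2 : all_moments P (fun w => S w ^+ 2).
Proof.
under eq_fun do rewrite S2E.
apply: all_momentsM; first exact: all_moments_cst.
exact: all_moments_quadratic_form.
Qed.

Let inl_inj : injective (@inl nat nat). Proof. by move=> i j []. Qed.
Let inr_inj : injective (@inr nat nat). Proof. by move=> i j []. Qed.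

Let measurable_b i (I' : nat) :
  measurable_fun [set: but_type V (inl I')] (b i : but_type V (inl I') -> R).
Proof.
apply: measurable_funM; first exact: measurable_cst.
apply: measurable_sum => j; apply: measurable_funM; first exact: measurable_cst.
exact: measurable_RV_but.
Qed.

Let measurableS : measurable_fun [set: T] S.
Proof.
apply: measurableT_comp.
  by apply: continuous_measurable_fun; exact: sqrt_continuous.
apply: measurable_sum => i; apply: measurable_funX.
apply: (@measurable_fun_but _ _ _ _ _ V (inl 0%N)); exact: measurable_b.
Qed.

Let mixture (f : R -> \bar R) :
  measurable_fun [set: R] f -> (forall y, (0 <= f y)%E) ->
  (\int[P]_w f (W w) = \int[P]_w \int[normal_prob 0 1]_y f (S w * y)%R)%E.
Proof.
move=> mf f0; under eq_integral do rewrite WE.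
exact: (ge0_integral_gauss_mixture indepV normalV _ inl_inj measurable_b).
Qed.

Let symQ j k : Q j k = Q k j.
Proof. by apply: eq_bigr => i _; rewrite mulrC. Qed.

Let QE (j k : 'I_n.+1) :
  Q j k = ((cov_mx alpha n.+1)^T *m cov_mx alpha n.+1) j k.
Proof.
by rewrite mxE; apply: eq_bigr => i _; rewrite mxE /m !inord_val.
Qed.

Let Rintegral_one_sub_sqr :
  \int[P]_w `|1 - S w ^+ 2| <= C4 alpha / Num.sqrt n.+1%:R.
Proof.
have hm : all_moments P (fun w => 1 - S w ^+ 2).
  by apply: all_momentsD; [exact: all_moments_cst|exact: all_momentsN].
apply: (le_trans (Rintegral_norm_le_sqrt hm)).
have C40 : 0 <= C4 alpha / Num.sqrt n.+1%:R.
  by rewrite divr_ge0 ?sqrtr_ge0// mulr_ge0 ?sqrtr_ge0// ltW// c2_gt0.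
rewrite -(ger0_norm C40) -sqrtr_sqr ler_sqrt ?sqr_ge0//.
apply: le_trans (variance_bound (ltn0Sn n)).
pose q := quadratic_form V inr Q n.+1; set k := c2 / _.
have hq : all_moments P q by exact: all_moments_quadratic_form.
have hc (r : R) := all_moments_cst P r.
have hq2 := all_momentsX 2 hq.
have -> : \int[P]_w (1 - S w ^+ 2) ^+ 2 =
    \int[P]_w (1 + (- (2 * k) * q w + k ^+ 2 * q w ^+ 2)).
  by apply: eq_Rintegral => w _; rewrite S2E -/k -/(q w); ring.
rewrite RintegralT_D//; last by apply: all_momentsD; exact: all_momentsM.
rewrite RintegralT_D; [|exact: all_momentsM|exact: all_momentsM].
rewrite !RintegralT_Z// RintegralT_cst.
rewrite (Rintegral_quadratic_form indepV normalV inr_inj symQ).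
rewrite (Rintegral_quadratic_form_sqr indepV normalV inr_inj symQ).
have -> : \sum_(i < n.+1) Q i i = fro2 (cov_mx alpha n.+1).
  rewrite -fro2_tr fro2_trace trmxK.
  by apply: eq_bigr => i _; rewrite QE.
have -> : \sum_(i < n.+1) \sum_(j < n.+1) Q i j ^+ 2 =
    fro2 ((cov_mx alpha n.+1)^T *m cov_mx alpha n.+1).
  by apply: eq_bigr => i _; apply: eq_bigr => j _; rewrite QE.
by rewrite le_eqVlt; apply/orP; left; apply/eqP; ring.
Qed.

Context (d' : measure_display) (T' : measurableType d') (P' : probability T' R)
  (N : {RV P' >-> R}).
Hypothesis hN : forall A : set R, measurable A ->
  distribution P' N A = normal_prob 0 1 A.

Lemma dKol_Z12_le : (dKol W N <= (C4 alpha / Num.sqrt n.+1%:R)%:E)%E.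
Proof.
apply: (@le_trans _ _ (\int[P]_w `|1 - S w ^+ 2|)%:E).
  by apply: dKol_mixture => // w; exact: sqrtr_ge0.
by rewrite lee_fin.
Qed.

Lemma dW_Z12_le :
  (dW W N <= (Num.sqrt (2 / pi) * C4 alpha / Num.sqrt n.+1%:R)%:E)%E.
Proof.
apply: (@le_trans _ _ (Num.sqrt (2 / pi) * \int[P]_w `|1 - S w ^+ 2|)%:E).
  by apply: dW_mixture => // w; exact: sqrtr_ge0.
by rewrite lee_fin -mulrA ler_wpM2l ?sqrtr_ge0.
Qed.

End fixed_size.

End normal_approximation.

Lemma gauss_cdf_scaled (R : realType) (s z : R) : 0 < s ->
  normal_prob 0 s `]-oo, z]%classic = (gauss_cdf (z / s))%:E.
Proof.
move=> s0; pose A : set (measurableTypeR R) := `]-oo, z]%classic.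
have mA : measurable A by exact: measurable_itv.
have mI : measurable_fun [set: R] (fun x => (\1_A x)%:E : \bar R).
  by apply/measurable_EFinP; exact: measurable_indic.
have I0 x : (0 <= (\1_A x)%:E :> \bar R)%E by rewrite lee_fin.
transitivity (\int[normal_prob 0 s]_x (\1_A x)%:E)%E.
  by rewrite integral_indic// setIT.
rewrite (ge0_integral_normal_affine 0 s0 mI I0) gauss_cdfE.
pose B : set (measurableTypeR R) := `]-oo, z / s]%classic.
transitivity (\int[normal_prob 0 1]_x (\1_B x)%:E)%E; last first.
  by rewrite integral_indic ?setIT//; exact: measurable_itv.
apply: eq_integral => x _; rewrite !indicE addr0; congr ((nat_of_bool _)%:R%:E).
rewrite /A /B !mem_setE !in_itv/= ler_pdivlMr// mulrC.
by [].
Qed.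

(* [N] is an arbitrary standard normal random variable, possibly on another
   probability space. *)
Theorem theorem11 (R : realType)
    (d : measure_display) (T : measurableType d) (P : probability T R)
    (alpha : R) (halpha : `|alpha| < 1)
    (xi eta : nat -> {RV P >-> R})
    (hnoise : iid_standard_normal_noises xi eta)
    (d' : measure_display) (T' : measurableType d') (P' : probability T' R)
    (N : {RV P' >-> R})
    (hN : forall A : set R, measurable A ->
            distribution P' N A = normal_prob 0 1 A) :
  let W (n : nat) : {RV P >-> R} :=
    scale_mfun (Num.sqrt ((1 - alpha ^+ 2) ^+ 3 / (1 + alpha ^+ 2))
               * Num.sqrt n%:R) (Z12 alpha xi eta n) in
  let V (n : nat) : {RV P >-> R} :=
    scale_mfun (Num.sqrt n%:R) (Z12 alpha xi eta n) in
  (forall n : nat, (0 < n)%N ->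
     (dKol (W n) N <= (C4 alpha / Num.sqrt n%:R)%:E)%E
     /\ (dW (W n) N
         <= (Num.sqrt (2 / pi) * C4 alpha / Num.sqrt n%:R)%:E)%E)
  /\ cvg_in_distribution V
       (normal_prob 0
          (Num.sqrt ((1 + alpha ^+ 2) / (1 - alpha ^+ 2) ^+ 3))).
Proof.
move=> W V.
have bound n : (0 < n)%N ->
    (dKol (W n) N <= (C4 alpha / Num.sqrt n%:R)%:E)%E
    /\ (dW (W n) N <= (Num.sqrt (2 / pi) * C4 alpha / Num.sqrt n%:R)%:E)%E.
  case: n => // n _; split; first exact: dKol_Z12_le.
  exact: dW_Z12_le.
split=> // z _.
have c2p := c2_gt0 halpha; set c2 := _ / _ in c2p.
pose k := Num.sqrt c2; have k0 : 0 < k by rewrite sqrtr_gt0.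
have sE : Num.sqrt ((1 + alpha ^+ 2) / (1 - alpha ^+ 2) ^+ 3) = k^-1.
  by rewrite -invf_div -/c2 sqrtrV// ltW.
have sp : 0 < k^-1 by rewrite invr_gt0.
have limE := gauss_cdf_scaled z sp; rewrite invrK in limE.
rewrite sE [X in _ --> X](_ : _ = (gauss_cdf (z * k))%:E); last exact: limE.
(* Since [W n = k V n] with [k > 0], the rate for [W n] at the point [z * k] yields the limit for
   [V n] at [z]. *)
have cdfVW n : cdf (V n) z = cdf (W n) (z * k).
  rewrite /cdf; transitivity (P [set w | V n w <= z]).
    by congr (P _); apply/seteqP; split => w; rewrite /= in_itv.
  transitivity (P [set w | W n w <= z * k]); last first.
    by congr (P _); apply/seteqP; split => w; rewrite /= in_itv.
  have WV w : W n w = V n w * k by rewrite /W /V /= -/c2 -/k; ring.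
  by congr (P _); apply/seteqP; split => w; rewrite /mkset WV ler_pM2r.
under eq_fun do rewrite cdfVW.
have cdfN : cdf N (z * k) = (gauss_cdf (z * k))%:E.
  by rewrite gauss_cdfE; exact: hN.
have fin n : cdf (W n) (z * k) \is a fin_num.
  by rewrite ge0_fin_numE// (le_lt_trans (cdf_le1 _ _)) ?ltry.
rewrite (_ : (fun n => _) = EFin \o (fun n => fine (cdf (W n) (z * k)))); last first.
  by apply/funext => n; rewrite /= fineK.
apply: cvg_EFin; first exact: nearW.
apply/cvgrPdist_le => e e0; near=> n.
have n0 : (0 < n)%N by near: n; exact: nbhs_infty_gt.
have np : 0 < Num.sqrt n%:R :> R by rewrite sqrtr_gt0 ltr0n.
have h : (`|cdf (W n) (z * k) - cdf N (z * k)| <= (C4 alpha / Num.sqrt n%:R)%:E)%E.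
  apply: le_trans (bound n n0).1; apply: ereal_sup_ubound.
  by exists (z * k).
rewrite /= distrC -lee_fin; apply: le_trans (_ : _ <= (C4 alpha / Num.sqrt n%:R)%:E)%E _.
  by move: h; rewrite cdfN -{1}(fineK (fin n)) -EFinB.
rewrite lee_fin ler_pdivrMr//.
rewrite -ler_pdivrMl//.
(* The required threshold is [n >= (e^-1 * C4 alpha) ^ 2]. *)
apply: (le_trans (ler_norm _)); rewrite -sqrtr_sqr ler_sqrt ?ler0n//.
near: n; exact: nbhs_infty_ger.
Unshelve. all: by end_near. Qed.
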